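(* Let $d,k$ be positive integers. (a) $\mathcal{L}_\mathbb{R}(d,k)\leq \frac{(k-1)\sqrt{k+2}+2}{k(k+1)}$, and if equality holds, then there exist $\binom{k+1}{2}$ equiangular lines in $\mathbb{R}^k$ and $d\equiv -k\pmod{\binom{k+1}{2}}$. (b) $\mathcal{L}_\mathbb{C}(d,k)\leq \frac{(k-1)\sqrt{k+1}+1}{k^2}$, and if equality holds, then there exist $k^2$ equiangular lines in $\mathbb{C}^k$ and $d\equiv -k\pmod{k^2}$.
   Context: Let $\mathbb{F}\in\{\mathbb{R},\mathbb{C}\}$. For a nonzero (Borel) probability mass $\mu$ on $\mathbb{F}^k$ with support $\operatorname{supp}(\mu)$, define \[L_\mathbb{F}(\mu):=\inf_{y\in\operatorname{supp}(\mu)\setminus\{0\}}\ \inf_{v\in\mathbb{F}^k\setminus\{0\}}\frac{\mathbb{E}_{x\sim\mu}|\langle v,x\rangle|}{|\langle v,y\rangle|}.\] Let $\mathcal{P}_\mathbb{F}(d,k)$ be the set of probability masses on $\mathbb{F}^k$ that are the uniform distribution on some multiset of $d+k$ vectors of $\mathbb{F}^k$ spanning $\mathbb{F}^k$, and $\mathcal{L}_\mathbb{F}(d,k):=\sup_{\mu\in\mathcal{P}_\mathbb{F}(d,k)}L_\mathbb{F}(\mu)$. A system of $N$ equiangular lines in $\mathbb{F}^k$ is a set of $N$ unit vectors in $\mathbb{F}^k$ whose pairwise inner products all have the same absolute value. *)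

(* Defs.v *)
From mathcomp Require Export all_boot all_order all_algebra.
From mathcomp Require Export all_classical all_reals all_analysis.
From mathcomp Require Export complex.
Export Order.TTheory GRing.Theory Num.Theory numFieldNormedType.Exports.

Set Implicit Arguments.
Unset Strict Implicit.
Unset Printing Implicit Defensive.

Local Open Scope classical_set_scope.
Local Open Scope ring_scope.

(* The scalars F in {R, C}. The modulus is real-valued, whereas the MathComp
   norm of R[i] takes its values in R[i]. *)
Variant scalar_kind := RealScalars | ComplexScalars.

Definition scalar (R : realType) (K : scalar_kind) : numFieldType :=
  match K with RealScalars => R : numFieldType | ComplexScalars => R[i] end.

Definition conj_scalar (R : realType) (K : scalar_kind) :
    scalar R K -> scalar R K :=
  match K with
  | RealScalars => fun x : R => x
  | ComplexScalars => fun z : R[i] => conjc z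
  end.

Definition modulus (R : realType) (K : scalar_kind) : scalar R K -> R :=
  match K with
  | RealScalars => fun x : R => `|x|
  | ComplexScalars => fun z : R[i] => complex.Re `|z|
  end.

Section Definitions.
Variables (R : realType) (K : scalar_kind).

Definition vec (k : nat) := 'rV[scalar R K]_k.

Definition inner (k : nat) (v x : vec k) : scalar R K :=
  \sum_(i < k) conj_scalar (v 0 i) * x 0 i.

Definition borel_vec (k : nat) := g_sigma_algebraType (@open (vec k)).

Definition supp (k : nat) (mu : probability (borel_vec k) R) : set (vec k) :=
  [set y : vec k | forall U : set (vec k), open U -> U y -> (0 < mu U)%E].

(* The quotient is that of \bar R, where 0^-1 = +oo: the vectors v orthogonal to
   y do not contribute to the infimum as soon as the expectation is nonzero,
   which is always the case if supp mu spans the space. *)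
Definition Lval (k : nat) (mu : probability (borel_vec k) R) : \bar R :=
  ereal_inf [set ereal_inf
      [set ((\int[mu]_x (modulus (inner v x))%:E) / (modulus (inner v y))%:E)%E
      | v in [set v : vec k | v != 0]]
    | y in supp mu `\ 0].

(* A multiset of m vectors is given by an m-row matrix listing its elements;
   the vectors span the space iff the matrix is row_full. *)
Definition uniform_on (k m : nat) (X : 'M[scalar R K]_(m, k))
    (mu : probability (borel_vec k) R) : Prop :=
  forall A : set (borel_vec k), measurable A ->
    mu A = ((m%:R^-1)%:E * \sum_(i < m) dirac (row i X : borel_vec k) A)%E.

Definition Pset (d k : nat) : set (probability (borel_vec k) R) :=
  [set mu | exists2 X : 'M[scalar R K]_(d + k, k),
     row_full X & uniform_on X mu].
Arguments Pset : clear implicits.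

Definition calL (d k : nat) : \bar R := ereal_sup [set Lval mu | mu in Pset d k].

(* The lines spanned by the v i have to be distinct: without this clause the
   unit multiples of a single vector would qualify, with common modulus 1. *)
Definition equiangular_lines_exist (N k : nat) : Prop :=
  exists v : 'I_N -> vec k,
    [/\ forall i, inner (v i) (v i) = 1,
        forall i j, i != j -> ~~ (v i == v j)%MS
      & exists a : R, forall i j, i != j -> modulus (inner (v i) (v j)) = a].

End Definitions.

(* Main.v *)
From HB Require Import structures.
From mathcomp Require Import ring lra measurable_realfun.
Require Import Defs.

(* Put the N = d + k vectors, by a linear change of coordinates, in Lewis
   position: x_i = w_i u_i with unit vectors u_i and sum_i w_i u_i u_i^* = I.
   The weights are a fixed point of w_i |-> (x_i^* G(w)^-1 x_i)^(1/2), where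
   G(w) = sum_j x_j x_j^* / w_j; this map is monotone and homogeneous of degree
   1/2, so Knaster-Tarski applies. Testing L(mu) on v = u_i and averaging with
   the weights w_i gives, for t_ij = |<u_i, u_j>|,
     L(mu) sum_i w_i^2 <= (1/N) sum_ij w_i w_j t_ij.
   On [0, 1] the function t is below an even quartic A + B t^2 - C t^4, C > 0,
   with equality exactly at t = 1 and at alpha = 1/sqrt(k + 2) (real case) or
   1/sqrt(k + 1) (complex case). The second moment of t_ij is known by isotropy,
   the fourth one is bounded below by Cauchy-Schwarz against the invariant
   4-tensors, and (sum_i w_i)^2 <= N sum_i w_i^2 concludes.
   If the supremum equals the bound, an ultrafilter limit of the Lewis positions
   of near-maximisers is a limit configuration with equality everywhere: the
   w_i are all equal and t_ij is alpha or 1. By isotropy all classes of parallel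
   u_i have the same size N / M, and there are M of them. *)

Set Implicit Arguments.
Unset Strict Implicit.
Unset Printing Implicit Defensive.

Local Open Scope ring_scope.

(** * Real and complex scalars treated uniformly *)

Definition emb (R : realType) (K : scalar_kind) : R -> scalar R K :=
  match K with
  | RealScalars => fun x : R => x
  | ComplexScalars => real_complex R
  end.

Section Scalars.
Variables (R : realType) (K : scalar_kind).
Local Notation F := (scalar R K).

Lemma emb_is_zmod_morphism : zmod_morphism (@emb R K).
Proof. by case: K => x y //; exact: rmorphB. Qed.

Lemma emb_is_monoid_morphism : monoid_morphism (@emb R K).
Proof.
case: K; first by split.
by split; [exact: rmorph1 | move=> x y; exact: rmorphM].
Qed.

HB.instance Definition _ :=
  GRing.isZmodMorphism.Build R F (@emb R K) emb_is_zmod_morphism.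
HB.instance Definition _ :=
  GRing.isMonoidMorphism.Build R F (@emb R K) emb_is_monoid_morphism.

Lemma conj_scalar_is_zmod_morphism : zmod_morphism (@conj_scalar R K).
Proof. by case: K => x y //; exact: rmorphB. Qed.

Lemma conj_scalar_is_monoid_morphism : monoid_morphism (@conj_scalar R K).
Proof.
case: K; first by split.
by split; [exact: rmorph1 | move=> x y; exact: rmorphM].
Qed.

HB.instance Definition _ :=
  GRing.isZmodMorphism.Build F F (@conj_scalar R K)
    conj_scalar_is_zmod_morphism.
HB.instance Definition _ :=
  GRing.isMonoidMorphism.Build F F (@conj_scalar R K)
    conj_scalar_is_monoid_morphism.

Lemma conj_scalarK : involutive (@conj_scalar R K).
Proof. by case: K => // x; exact: conjcK. Qed.

Lemma conj_emb (x : R) : conj_scalar (emb K x) = emb K x.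
Proof. by case: K => //; exact: conjc_real. Qed.

Lemma emb_modulus (x : F) : emb K (modulus x) = `|x|.
Proof.
by case: K x => //= x; rewrite RRe_real // ger0_real.
Qed.

Lemma ler_emb (x y : R) : (emb K x <= emb K y) = (x <= y).
Proof. by case: K => //; exact: lecR. Qed.

Lemma ltr_emb (x y : R) : (emb K x < emb K y) = (x < y).
Proof. by rewrite !lt_def ler_emb (inj_eq (fmorph_inj (@emb R K))). Qed.

Lemma emb_inj : injective (@emb R K).
Proof. exact: fmorph_inj. Qed.

Lemma modulus_ge0 (x : F) : 0 <= modulus x.
Proof. by rewrite -ler_emb emb_modulus rmorph0. Qed.

Lemma modulusM (x y : F) : modulus (x * y) = modulus x * modulus y.
Proof. by apply: emb_inj; rewrite rmorphM /= !emb_modulus normrM. Qed.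

Lemma modulus_emb (x : R) : modulus (emb K x) = `|x|.
Proof.
apply: emb_inj; rewrite emb_modulus.
by case: K => //=; rewrite normc_def /= expr0n addr0 sqrtr_sqr.
Qed.

Lemma modulus_eq0 (x : F) : (modulus x == 0) = (x == 0).
Proof. by rewrite -(inj_eq emb_inj) emb_modulus rmorph0 normr_eq0. Qed.

Lemma modulus_conj (x : F) : modulus (conj_scalar x) = modulus x.
Proof.
apply: emb_inj; rewrite !emb_modulus.
by case: K x => //= -[a b]; rewrite !normc_def /= sqrrN.
Qed.

Lemma mul_conj (x : F) : x * conj_scalar x = emb K (modulus x ^+ 2).
Proof.
rewrite rmorphXn /= emb_modulus; case: K x => /= [x|[a b]].
  by rewrite real_normK ?num_real.
rewrite -add_Re2_Im2 /=; apply/eqP; rewrite eq_complex /=.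
by rewrite !expr2 mulrN opprK mulrN [b * a]mulrC addNr !eqxx.
Qed.

Lemma mul_conj_ge0 (x : F) : 0 <= x * conj_scalar x.
Proof. by rewrite mul_conj -(rmorph0 (@emb R K)) ler_emb sqr_ge0. Qed.

Lemma modulus_dist (x y : F) : `|modulus x - modulus y| <= modulus (x - y).
Proof.
rewrite ler_norml; apply/andP; split.
  rewrite -ler_emb rmorphN rmorphB /= !emb_modulus lerNl opprB.
  by rewrite distrC lerB_dist.
by rewrite -ler_emb rmorphB /= !emb_modulus lerB_dist.
Qed.

Lemma emb_ge0_modulus (x : F) : 0 <= x -> emb K (modulus x) = x.
Proof. by move=> x0; rewrite emb_modulus ger0_norm. Qed.

End Scalars.

(** * Adjoints, inner products and positive definite matrices *)

Section Adjoint.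
Variables (R : realType) (K : scalar_kind).
Local Notation F := (scalar R K).

(** Vectors are rows and matrices act on the right: [x *m adjoint v] is the scalar [inner v x], and
    [adjoint u *m u] is the rank-one map sending y to [inner u y *: u]. *)
Definition adjoint m n (A : 'M[F]_(m, n)) : 'M[F]_(n, m) :=
  (map_mx (@conj_scalar R K) A)^T.

Lemma adjointK m n (A : 'M[F]_(m, n)) : adjoint (adjoint A) = A.
Proof. by apply/matrixP => i j; rewrite !mxE conj_scalarK. Qed.

Lemma adjointM m n p (A : 'M[F]_(m, n)) (B : 'M[F]_(n, p)) :
  adjoint (A *m B) = adjoint B *m adjoint A.
Proof. by rewrite /adjoint map_mxM trmx_mul. Qed.

Lemma adjoint0 m n : adjoint (0 : 'M[F]_(m, n)) = 0.
Proof. by rewrite /adjoint map_mx0 trmx0. Qed.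

Lemma adjointB m n (A B : 'M[F]_(m, n)) :
  adjoint (A - B) = adjoint A - adjoint B.
Proof. by rewrite /adjoint map_mxB linearB. Qed.

Lemma adjointN m n (A : 'M[F]_(m, n)) : adjoint (- A) = - adjoint A.
Proof. by rewrite /adjoint map_mxN linearN. Qed.

Lemma adjointZ m n (a : F) (A : 'M[F]_(m, n)) :
  adjoint (a *: A) = conj_scalar a *: adjoint A.
Proof. by rewrite /adjoint map_mxZ linearZ. Qed.

Lemma adjoint_sum m n I (r : seq I) (P : pred I) (A : I -> 'M[F]_(m, n)) :
  adjoint (\sum_(i <- r | P i) A i) = \sum_(i <- r | P i) adjoint (A i).
Proof. by rewrite /adjoint map_mx_sum linear_sum. Qed.

Lemma adjoint_inv n (A : 'M[F]_n) : adjoint (invmx A) = invmx (adjoint A).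
Proof. by rewrite /adjoint map_invmx trmx_inv. Qed.

Lemma adjoint_block m1 m2 n1 n2 (A : 'M[F]_(m1, n1)) B C (D : 'M[F]_(m2, n2)) :
  adjoint (block_mx A B C D) =
  block_mx (adjoint A) (adjoint C) (adjoint B) (adjoint D).
Proof. by rewrite /adjoint map_block_mx tr_block_mx. Qed.

Lemma adjoint_row m n1 n2 (A : 'M[F]_(m, n1)) (B : 'M[F]_(m, n2)) :
  adjoint (row_mx A B) = col_mx (adjoint A) (adjoint B).
Proof. by rewrite /adjoint map_row_mx tr_row_mx. Qed.

Lemma innerE k (v x : 'rV[F]_k) : inner v x = (x *m adjoint v) 0 0.
Proof. by rewrite mxE; apply: eq_bigr => i _; rewrite !mxE mulrC. Qed.

Lemma mul_adjoint k (v x : 'rV[F]_k) : x *m adjoint v = (inner v x)%:M.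
Proof. by rewrite innerE [LHS]mx11_scalar. Qed.

Lemma inner_mulmx k (v x : 'rV[F]_k) (A : 'M[F]_k) :
  inner v (x *m A) = inner (v *m adjoint A) x.
Proof. by rewrite !innerE adjointM adjointK mulmxA. Qed.

Lemma conj_inner k (v x : 'rV[F]_k) : conj_scalar (inner v x) = inner x v.
Proof.
rewrite /inner rmorph_sum; apply: eq_bigr => i _.
by rewrite rmorphM /= conj_scalarK mulrC.
Qed.

Lemma innerZr k a (v x : 'rV[F]_k) : inner v (a *: x) = a * inner v x.
Proof. by rewrite !innerE -scalemxAl mxE. Qed.

Lemma innerZl k a (v x : 'rV[F]_k) :
  inner (a *: v) x = conj_scalar a * inner v x.
Proof. by rewrite !innerE adjointZ -scalemxAr mxE. Qed.

Lemma innerBr k (v x y : 'rV[F]_k) : inner v (x - y) = inner v x - inner v y.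
Proof. by rewrite !innerE mulmxBl !mxE. Qed.

Lemma innerBl k (v w x : 'rV[F]_k) : inner (v - w) x = inner v x - inner w x.
Proof. by rewrite !innerE adjointB mulmxBr !mxE. Qed.

Lemma inner0r k (v : 'rV[F]_k) : inner v 0 = 0.
Proof. by rewrite innerE mul0mx mxE. Qed.

Lemma inner0l k (v : 'rV[F]_k) : inner 0 v = 0.
Proof. by rewrite innerE adjoint0 mulmx0 mxE. Qed.

Lemma inner_ge0 k (v : 'rV[F]_k) : 0 <= inner v v.
Proof. by apply: sumr_ge0 => i _; rewrite mulrC mul_conj_ge0. Qed.

Lemma inner_eq0 k (v : 'rV[F]_k) : (inner v v == 0) = (v == 0).
Proof.
apply/eqP/eqP => [/eqP|->]; last by rewrite inner0r.
rewrite psumr_eq0 => [/allP v0|i _]; last by rewrite mulrC mul_conj_ge0.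
apply/rowP => i; have /= := v0 i; rewrite mem_index_enum => /(_ isT).
rewrite mulrC mul_conj -(rmorph0 (@emb R K)) (inj_eq (@emb_inj R K)).
by rewrite expf_eq0 /= modulus_eq0 mxE => /eqP.
Qed.

Definition posdef k (H : 'M[F]_k) :=
  adjoint H = H /\ forall v, v != 0 -> 0 < inner v (v *m H).

(** Induction on k, splitting off the first coordinate and passing to the Schur complement S; T
    comes out upper triangular, as the inverse of a Cholesky factor. *)
Lemma posdef_orthonormalize k (H : 'M[F]_k) :
  posdef H -> exists T : 'M[F]_k, adjoint T *m H *m T = 1%:M.
Proof.
elim: k H => [|k IHk] H; first by exists 1%:M; apply/matrixP => -[].
move: H; rewrite -[k.+1]/(1 + k)%N => H [Hh Hp].
pose a : R := modulus (H 0 0); pose b : 'rV[F]_k := ursubmx (H : 'M[F]_(1 + k)).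
pose B : 'M[F]_k := drsubmx (H : 'M[F]_(1 + k)).
have aE : H 0 0 = emb K a /\ 0 < a.
  pose e : 'rV[F]_(k.+1) := delta_mx 0 0.
  have := Hp e; have -> : inner e (e *m H) = H 0 0.
    rewrite innerE -rowE !mxE (bigD1 0) //= big1 ?addr0.
      by rewrite !mxE !eqxx rmorph1 mulr1.
    by move=> i /negPf i0; rewrite !mxE i0 andbF rmorph0 mulr0.
  have /[swap]/[apply] : e != 0.
    apply/eqP => /matrixP /(_ 0 0); rewrite !mxE !eqxx => /eqP.
    by rewrite oner_eq0.
  move=> H0; rewrite emb_ge0_modulus ?(ltW H0) //; split=> //.
  by rewrite lt_def modulus_ge0 modulus_eq0 gt_eqF.
have [{}aE a0] := aE.
have bh : dlsubmx (H : 'M[F]_(1 + k)) = adjoint b.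
  apply/matrixP => i j; rewrite -{1}Hh !mxE.
  by congr (conj_scalar (H _ _)); apply: val_inj.
have HE : H = block_mx (emb K a)%:M b (adjoint b) B :> 'M[F]_(1 + k).
  rewrite -[LHS](@submxK _ 1 k 1 k) bh; congr block_mx.
  apply/matrixP => i j; rewrite !ord1 !mxE eqxx mulr1n -aE.
  by congr (H _ _); apply: val_inj.
have Bh : adjoint B = B.
  by move: Hh; rewrite HE adjoint_block => /eq_block_mx[].
pose S := B - (emb K a)^-1 *: (adjoint b *m b).
have ea0 : emb K a != 0 by rewrite fmorph_eq0 gt_eqF.
have conja : conj_scalar (emb K a)^-1 = (emb K a)^-1.
  by rewrite fmorphV /= conj_emb.
have /IHk[T TE] : posdef S.
  split; first by rewrite adjointB Bh adjointZ conja adjointM adjointK.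
  (* This z makes the first block of [row_mx z v *m H] vanish, so the form of H at (z, v) is the
     form of S at v. *)
  move=> v v0; pose z : 'rV[F]_1 := - ((emb K a)^-1 *: (v *m adjoint b)).
  have /Hp : row_mx z v != 0 :> 'rV[F]_(1 + k).
    apply: contra v0 => /eqP /(congr1 (@rsubmx _ 1 1 k)).
    by rewrite row_mxKr linear0 => ->.
  rewrite innerE HE mul_row_block adjoint_row mul_row_col.
  rewrite innerE; congr (0 < _ 0 0).
  have -> : z *m (emb K a)%:M + v *m adjoint b = 0.
    by rewrite mul_mx_scalar scalerN scalerA mulfV // scale1r addNr.
  rewrite mul0mx add0r; congr (_ *m _).
  rewrite /S mulmxBr addrC; congr (_ + _).
  by rewrite /z mulNmx -scalemxAr -scalemxAl mulmxA.
pose s := emb K (Num.sqrt a).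
have s0 : s != 0 by rewrite fmorph_eq0 gt_eqF // sqrtr_gt0.
have ss : s * s = emb K a.
  by rewrite -rmorphM /= -expr2 sqr_sqrtr // ltW.
have conjs : conj_scalar s^-1 = s^-1 by rewrite fmorphV /= conj_emb.
(* The first column is normalised by s, the square root of a; the entries above T make the other
   columns orthogonal to it for the form H. *)
exists (block_mx (s^-1)%:M (- ((emb K a)^-1 *: (b *m T))) 0 T : 'M[F]_(1 + k)).
rewrite -mulmxA HE mulmx_block adjoint_block mulmx_block.
have -> : (emb K a)%:M *m - ((emb K a)^-1 *: (b *m T)) + b *m T = 0.
  by rewrite mul_scalar_mx scalerN scalerA mulfV // scale1r addNr.
have -> : adjoint b *m - ((emb K a)^-1 *: (b *m T)) + B *m T = S *m T.
  by rewrite /S mulmxBl mulmxN -scalemxAr -scalemxAl mulmxA addrC.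
have -> : adjoint (s^-1)%:M = (s^-1)%:M :> 'M[F]_1.
  by apply/matrixP => i j; rewrite !ord1 !mxE eqxx mulr1n conjs.
rewrite adjoint0 !mulmx0 !mul0mx !addr0 add0r.
have -> : adjoint T *m (S *m T) = 1%:M by rewrite mulmxA TE.
have -> : (s^-1)%:M *m ((emb K a)%:M *m (s^-1)%:M) = 1%:M :> 'M[F]_1.
  by rewrite -!scalar_mxM -ss -mulrA mulfV // mulr1 mulVf.
have -> : adjoint (- ((emb K a)^-1 *: (b *m T))) *m
     ((emb K a)%:M *m (s^-1)%:M) + adjoint T *m (adjoint b *m (s^-1)%:M) = 0.
  rewrite adjointN adjointZ conja adjointM mulNmx -scalar_mxM !mul_mx_scalar.
  by rewrite -scalemxAr scalerA mulrAC mulfV // mul1r addNr.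
by rewrite -scalar_mx_block.
Qed.

End Adjoint.

(** * Lewis position *)

(** Knaster-Tarski in the box of functions between c and C: the fixed point is the pointwise
    supremum of the w with w <= Phi w. Monotonicity is asked above c, since [lewis_form_mono]
    requires positive weights. *)
Lemma monotone_fixpoint (R : realType) (I : Type) (Phi : (I -> R) -> I -> R)
    (c C : R) :
    c <= C ->
    (forall w w', (forall i, c <= w i) -> (forall i, w i <= w' i) ->
       forall i, Phi w i <= Phi w' i) ->
    (forall i, c <= Phi (fun=> c) i) -> (forall i, Phi (fun=> C) i <= C) ->
  exists w, (forall i, c <= w i) /\ (forall i, Phi w i = w i).
Proof.
move=> cC mono Phic PhiC.
pose S := [set w : I -> R |
  [/\ forall i, c <= w i, forall i, w i <= C
    & forall i, w i <= Phi w i]]%classic.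
pose A i := [set w i | w in S]%classic.
have Sc : S (fun=> c) by split.
have supA i : has_sup (A i).
  split; first by exists c, (fun=> c).
  by exists C => _ [w [_ wC _] <-].
pose ws i := sup (A i).
have S_ws w : S w -> forall i, w i <= ws i.
  by move=> Sw i; apply: ub_le_sup; [case: (supA i) | exists w].
have cws i : c <= ws i := S_ws _ Sc i.
have ws_ub i (r : R) : (forall w, S w -> w i <= r) -> ws i <= r.
  by move=> ub; apply: ge_sup; [case: (supA i) | move=> _ [w Sw <-]; exact: ub].
have wsC i : ws i <= C by apply: ws_ub => w [].
have wsPhi i : ws i <= Phi ws i.
  apply: ws_ub => w Sw; have [cw _ wPhi] := Sw.
  by apply: le_trans (wPhi i) _; apply: mono => //; exact: S_ws.
have cPhi i : c <= Phi ws i by apply: le_trans (wsPhi i).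
have SPhi : S (Phi ws).
  split => // i; last exact: mono.
  by apply: le_trans (PhiC i); exact: mono.
(* [Phi ws] again lies in S, hence below its supremum [ws]. *)
exists ws; split=> // i; apply/eqP; rewrite eq_le wsPhi andbT.
exact: S_ws.
Qed.

Section LewisPosition.
Variables (R : realType) (K : scalar_kind) (k N : nat).
Local Notation F := (scalar R K).
Variable X : 'M[F]_(N, k).
Hypothesis X_full : row_full X.

Let x i : 'rV[F]_k := row i X.

Definition gram_op (w : 'I_N -> R) : 'M[F]_k :=
  \sum_j emb K (w j)^-1 *: (adjoint (x j) *m x j).

(** The modulus turns a scalar into a real number; for positive weights no information is lost, by
    [lewis_formE]. *)
Definition lewis_form (w : 'I_N -> R) i : R :=
  modulus (inner (x i) (x i *m invmx (gram_op w))).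

Lemma inner_gram_op w (y z : 'rV[F]_k) :
  inner y (z *m gram_op w) =
  \sum_j emb K (w j)^-1 * (inner (x j) z * inner y (x j)).
Proof.
rewrite innerE /gram_op mulmx_sumr mulmx_suml summxE; apply: eq_bigr => j _.
rewrite -scalemxAr mulmxA (mul_adjoint (x j)) mul_scalar_mx -!scalemxAl.
by rewrite mxE mxE -innerE.
Qed.

Lemma adjoint_gram_op w : adjoint (gram_op w) = gram_op w.
Proof.
rewrite adjoint_sum; apply: eq_bigr => j _.
by rewrite adjointZ conj_emb adjointM adjointK.
Qed.

Lemma inner_gram_opE w (y : 'rV[F]_k) : inner y (y *m gram_op w) =
  emb K (\sum_j (w j)^-1 * modulus (inner y (x j)) ^+ 2).
Proof.
rewrite inner_gram_op rmorph_sum; apply: eq_bigr => j _.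
by rewrite [RHS]rmorphM /= -mul_conj conj_inner [inner _ _ * _]mulrC.
Qed.

(** A vector at which the form vanishes is orthogonal to every row of X, hence zero, as the rows
    span. *)
Lemma posdef_gram_op w : (forall i, 0 < w i) -> posdef (gram_op w).
Proof.
move=> w0; split=> [|v v0]; first exact: adjoint_gram_op.
rewrite inner_gram_opE -(rmorph0 (@emb R K)) lt_def ler_emb.
have t0 j : 0 <= (w j)^-1 * modulus (inner v (x j)) ^+ 2.
  by rewrite mulr_ge0 ?sqr_ge0 // invr_ge0 ltW.
rewrite sumr_ge0 // andbT (inj_eq (@emb_inj R K)).
apply: contra v0; rewrite psumr_eq0 // => /allP z.
have Xv : X *m adjoint v = 0.
  apply/row_matrixP => i; rewrite row_mul mul_adjoint row0.
  have /= := z i; rewrite mem_index_enum => /(_ isT).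
  rewrite mulf_eq0 invr_eq0 gt_eqF //= expf_eq0 /= modulus_eq0 => /eqP ->.
  by rewrite raddf0.
have : adjoint v = 0 by apply: (row_full_inj X_full); rewrite Xv mulmx0.
by move=> /(congr1 (@adjoint R K _ _)); rewrite adjointK adjoint0 => ->.
Qed.

Lemma posdef_unit (H : 'M[F]_k) : posdef H -> H \in unitmx.
Proof.
move=> /posdef_orthonormalize[T] /mulmx1_unit[].
by rewrite unitmx_mul => /andP[].
Qed.

(** At y = x_i G(w)^-1 the form reads <y, y G(w)>, a sum of nonnegative terms. *)
Lemma lewis_formE w i : (forall j, 0 < w j) ->
  emb K (lewis_form w i) = inner (x i) (x i *m invmx (gram_op w)).
Proof.
move=> w0; rewrite emb_ge0_modulus //.
have Gu := posdef_unit (posdef_gram_op w0).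
rewrite inner_mulmx adjoint_inv adjoint_gram_op.
rewrite -{2}[x i](mulmxKV Gu) inner_gram_opE.
rewrite -(rmorph0 (@emb R K)) ler_emb sumr_ge0 // => j _.
by rewrite mulr_ge0 ?sqr_ge0 // invr_ge0 ltW.
Qed.

Lemma lewis_form_gt0 w i :
  (forall j, 0 < w j) -> x i != 0 -> 0 < lewis_form w i.
Proof.
move=> w0 xi0; rewrite lt_def modulus_ge0 andbT.
rewrite -(inj_eq (@emb_inj R K)) lewis_formE // rmorph0.
have Gp := posdef_gram_op w0; have Gu := posdef_unit Gp.
rewrite inner_mulmx adjoint_inv adjoint_gram_op -{2}[x i](mulmxKV Gu).
rewrite gt_eqF //; apply: Gp.2; apply: contra xi0 => /eqP y0.
by rewrite -[x i](mulmxKV Gu) y0 mul0mx.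
Qed.

(* Expand 0 <= <y - z, (y - z) G(w')> for y = x G(w)^-1 and z = x G(w')^-1. *)
Lemma lewis_form_mono w w' i : (forall j, 0 < w j) -> (forall j, w j <= w' j) ->
  lewis_form w i <= lewis_form w' i.
Proof.
move=> w0 ww'; have w'0 j : 0 < w' j := lt_le_trans (w0 j) (ww' j).
have Gu := posdef_unit (posdef_gram_op w0).
have Gu' := posdef_unit (posdef_gram_op w'0).
pose y := x i *m invmx (gram_op w); pose z := x i *m invmx (gram_op w').
have yG : y *m gram_op w = x i by rewrite mulmxKV.
have zG : z *m gram_op w' = x i by rewrite mulmxKV.
have qy : inner (x i) y = emb K (lewis_form w i) by rewrite lewis_formE.
have qz : inner (x i) z = emb K (lewis_form w' i) by rewrite lewis_formE.
have qy' : inner y (x i) = emb K (lewis_form w i).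
  by rewrite -conj_inner qy conj_emb.
have qz' : inner z (x i) = emb K (lewis_form w' i).
  by rewrite -conj_inner qz conj_emb.
have : 0 <= inner (y - z) ((y - z) *m gram_op w').
  rewrite inner_gram_opE -(rmorph0 (@emb R K)) ler_emb sumr_ge0 // => j _.
  by rewrite mulr_ge0 ?sqr_ge0 // invr_ge0 ltW.
rewrite mulmxBl innerBr !innerBl zG qy' qz'.
rewrite [inner z _]inner_mulmx adjoint_gram_op zG qy.
(* Larger weights give a smaller Gram operator, so the quadratic term at y is at most <y, y G(w)>,
   the Lewis form of w. *)
have : inner y (y *m gram_op w') <= emb K (lewis_form w i).
  rewrite -qy' -[in leRHS]yG !inner_gram_opE ler_emb ler_sum // => j _.
  by rewrite ler_wpM2r ?sqr_ge0 // lef_pV2 ?posrE.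
move=> h1; rewrite subr_ge0 => h2.
rewrite -(ler_emb K) -subr_le0; apply: le_trans h2 _.
by rewrite subr_le0.
Qed.

End LewisPosition.

Section LewisWeights.
Variables (R : realType) (K : scalar_kind) (k N : nat).
Local Notation F := (scalar R K).
Variable X : 'M[F]_(N, k).
Hypothesis X_full : row_full X.

Let x i : 'rV[F]_k := row i X.

Lemma gram_op_cst c : 0 < c ->
  gram_op X (fun=> c) = emb K c^-1 *: gram_op X (fun=> 1).
Proof.
move=> c0; rewrite /gram_op scaler_sumr; apply: eq_bigr => j _.
by rewrite invr1 rmorph1 scale1r.
Qed.

(** Homogeneity of degree one on constant weights, which are the corners of the box in which the
    fixed point is sought. *)
Lemma lewis_form_cst c i : 0 < c ->
  lewis_form X (fun=> c) i = c * lewis_form X (fun=> 1) i.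
Proof.
move=> c0; have cu : emb K c^-1 \is a GRing.unit.
  by rewrite unitfE fmorph_eq0 invr_eq0 gt_eqF.
have G1 := posdef_unit (posdef_gram_op X_full (fun i => ltr01)).
rewrite /lewis_form gram_op_cst // invmxZ ?unitmxZ //.
rewrite -scalemxAr innerZr modulusM -fmorphV invrK modulus_emb.
by rewrite ger0_norm // ltW.
Qed.

Lemma lewis_weights : exists w : 'I_N -> R, (forall i, 0 < w i) /\
  forall i, x i != 0 -> w i ^+ 2 = lewis_form X w i.
Proof.
(* Zero rows get weight 1, for Phi to preserve a box [c, C] with c > 0. *)
pose Phi w i := if x i == 0 then 1 else Num.sqrt (lewis_form X w i).
pose q i := lewis_form X (fun=> 1) i.
(* On nonzero rows, c <= q_i <= C gives sqrt (c q_i) >= c and sqrt (C q_i) <= C; the default 1 gives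
   c <= 1 <= C for the zero rows. *)
pose c := \big[Num.min/1]_(i | x i != 0) q i.
pose C := \big[Num.max/1]_(i | x i != 0) q i.
have c0 : 0 < c.
  by apply: lt_bigmin => // i; exact: lewis_form_gt0.
have c1 : c <= 1 by apply: bigmin_le_id.
have C1 : 1 <= C by apply: bigmax_ge_id.
have C0 : 0 < C by apply: lt_le_trans C1.
have [|w w' cw ww' i|i|i|w [cw wE]] := @monotone_fixpoint R 'I_N Phi c C.
- exact: le_trans C1.
- rewrite /Phi; case: ifP => // _.
  apply: ler_wsqrtr; apply: lewis_form_mono => // j.
  exact: lt_le_trans (cw j).
- rewrite /Phi; case: ifPn => // xi0.
  rewrite -[leLHS](gtr0_norm c0) -sqrtr_sqr. apply: ler_wsqrtr.
  rewrite lewis_form_cst // expr2; apply: ler_wpM2l; first exact: ltW.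
  exact: bigmin_le_cond.
- rewrite /Phi; case: ifPn => // xi0.
  rewrite -[leRHS](gtr0_norm C0) -sqrtr_sqr; apply: ler_wsqrtr.
  rewrite lewis_form_cst // expr2; apply: ler_wpM2l; first exact: ltW.
  exact: le_bigmax_cond.
exists w; split=> [i|i xi0]; first exact: lt_le_trans (cw i).
rewrite -[in LHS]wE /Phi (negPf xi0) sqr_sqrtr // modulus_ge0 //.
Qed.

(** Let T orthonormalise G(w). The squared norm of x_i T is the Lewis form w_i^2, so u_i = x_i T /
    w_i is a unit vector, and the weighted sum of the rank-one maps is
    [adjoint T *m gram_op X w *m T], the identity. *)
Lemma lewis_position : (0 < k)%N ->
  exists (T : 'M[F]_k) (w : 'I_N -> R) (u : 'I_N -> 'rV[F]_k),
  [/\ forall i, 0 <= w i, forall i, x i *m T = emb K (w i) *: u i,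
      forall i, inner (u i) (u i) = 1
    & \sum_i emb K (w i) *: (adjoint (u i) *m u i) = 1%:M].
Proof.
move=> k0; have [w [w0 wE]] := lewis_weights.
have Gp := posdef_gram_op X_full w0; have Gu := posdef_unit Gp.
have [T TG] := posdef_orthonormalize Gp.
have TT : invmx (gram_op X w) = T *m adjoint T.
  have GT : gram_op X w *m (T *m adjoint T) = 1%:M.
    by rewrite mulmxA; apply: mulmx1C; rewrite mulmxA.
  by rewrite -[LHS]mulmx1 -GT mulKmx.
(* A zero row gets weight 0 and an arbitrary unit vector, which exists as k > 0. *)
pose e0 : 'rV[F]_k := delta_mx 0 (Ordinal k0).
pose W i := if x i == 0 then 0 else w i.
pose u i := if x i == 0 then e0 else emb K (w i)^-1 *: (x i *m T).
exists T, W, u; split=> [i|i|i|].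
- by rewrite /W; case: ifP => // _; exact: ltW.
- rewrite /W /u; case: ifP => [/eqP ->|_].
    by rewrite mul0mx rmorph0 scale0r.
  by rewrite scalerA -rmorphM /= mulfV ?gt_eqF // rmorph1 scale1r.
- rewrite /u; case: ifPn => [_|xi0].
    by rewrite innerE /e0 -rowE !mxE /= rmorph1.
  rewrite innerZr innerZl conj_emb -[X in inner (_ *m X) _]adjointK.
  rewrite -inner_mulmx -mulmxA -TT -lewis_formE // -wE // -!rmorphM /=.
  rewrite mulrA -expr2 -exprMn.
  by rewrite mulVf ?gt_eqF // expr1n rmorph1.
rewrite -TG [X in _ *m X *m _]/gram_op mulmx_sumr mulmx_suml.
apply: eq_bigr => i _; rewrite /W /u; case: ifP => [/eqP xi0|_].
  by rewrite rmorph0 scale0r -/(x i) xi0 mulmx0 scaler0 mulmx0 mul0mx.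
rewrite adjointZ conj_emb -scalemxAl -scalemxAr !scalerA -!rmorphM /=.
rewrite mulfV ?gt_eqF // mul1r adjointM -scalemxAr -scalemxAl.
by rewrite !mulmxA.
Qed.
End LewisWeights.

(** * Fourth moments of unit vectors *)

Section FourthMoment.
Variables (R : realType) (K : scalar_kind).
Local Notation F := (scalar R K).

Lemma innerDr k (v x y : 'rV[F]_k) : inner v (x + y) = inner v x + inner v y.
Proof. by rewrite !innerE mulmxDl !mxE. Qed.

Lemma inner_sumr k I (r : seq I) (P : pred I) (v : 'rV[F]_k)
    (x : I -> 'rV[F]_k) :
  inner v (\sum_(i <- r | P i) x i) = \sum_(i <- r | P i) inner v (x i).
Proof.
apply: (big_morph (inner v)) => [y z|]; [exact: innerDr | exact: inner0r].
Qed.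

Lemma innerDl k (v w x : 'rV[F]_k) : inner (v + w) x = inner v x + inner w x.
Proof. by rewrite -conj_inner innerDr rmorphD /= !conj_inner. Qed.

Lemma inner_suml k I (r : seq I) (P : pred I) (v : I -> 'rV[F]_k)
    (x : 'rV[F]_k) :
  inner (\sum_(i <- r | P i) v i) x = \sum_(i <- r | P i) inner (v i) x.
Proof.
rewrite -conj_inner inner_sumr rmorph_sum.
by apply: eq_bigr => i _; rewrite /= conj_inner.
Qed.

(* |n P - W s q|^2 >= 0 for P = sum_i w_i p_i and W = sum_i w_i. *)
Lemma gram_sum_lower_bound m N (w : 'I_N -> R) (p : 'I_N -> 'rV[F]_m)
    (q : 'rV[F]_m) (g : 'I_N -> 'I_N -> R) (s n : R) :
  (forall i j, inner (p i) (p j) = emb K (g i j)) ->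
  (forall i, inner (p i) q = emb K s) -> inner q q = emb K n -> 0 < n ->
  (\sum_i w i) ^+ 2 * s ^+ 2 <= n * \sum_i \sum_j w i * w j * g i j.
Proof.
move=> pp pq qq n0; set W := \sum_i w i; set G := \sum_i \sum_j _.
pose P := \sum_i emb K (w i) *: p i.
have PP : inner P P = emb K G.
  rewrite inner_suml rmorph_sum; apply: eq_bigr => i _.
  rewrite inner_sumr rmorph_sum; apply: eq_bigr => j _.
  by rewrite innerZl innerZr conj_emb pp !rmorphM /= mulrA.
have Pq : inner P q = emb K (W * s).
  rewrite inner_suml mulr_suml rmorph_sum; apply: eq_bigr => i _.
  by rewrite innerZl conj_emb pq [RHS]rmorphM.
have qP : inner q P = emb K (W * s) by rewrite -conj_inner Pq conj_emb.
have := inner_ge0 (emb K n *: P - emb K (W * s) *: q).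
rewrite innerBl !innerBr !innerZl !innerZr !conj_emb PP Pq qP qq.
rewrite -!(rmorphM, rmorphB) -(rmorph0 (@emb R K)) ler_emb => h.
by rewrite -(ler_pM2l n0); nra.
Qed.

Definition tensor m n (x : 'rV[F]_m) (y : 'rV[F]_n) : 'rV[F]_(m * n) :=
  mxvec (x^T *m y).

Lemma inner_tensor m n (x z : 'rV[F]_m) (y t : 'rV[F]_n) :
  inner (tensor x y) (tensor z t) = inner x z * inner y t.
Proof.
rewrite /inner (reindex _ (curry_mxvec_bij _ _)) /= mulr_suml.
under [RHS]eq_bigr do rewrite mulr_sumr.
rewrite pair_bigA /=; apply: eq_bigr => -[i j] _ /=.
by rewrite !mxvecE !mxE !big_ord1 !mxE rmorphM /= mulrACA.
Qed.

Definition conj_vec k (x : 'rV[F]_k) : 'rV[F]_k := map_mx (@conj_scalar R K) x.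

Lemma inner_conj_vec k (x y : 'rV[F]_k) :
  inner (conj_vec x) (conj_vec y) = inner y x.
Proof.
by apply: eq_bigr => i _; rewrite !mxE conj_scalarK mulrC.
Qed.

Definition tensor4 k (x y z t : 'rV[F]_k) := tensor (tensor x y) (tensor z t).

Lemma inner_tensor4 k (x y z t x' y' z' t' : 'rV[F]_k) :
  inner (tensor4 x y z t) (tensor4 x' y' z' t') =
  inner x x' * inner y y' * (inner z z' * inner t t').
Proof. by rewrite !inner_tensor. Qed.

Lemma inner_delta k (x : 'rV[F]_k) a :
  inner x (delta_mx 0 a) = conj_scalar (x 0 a).
Proof. by rewrite innerE -rowE !mxE. Qed.

Lemma sum_conj k (x y : 'rV[F]_k) :
  \sum_a conj_scalar (x 0 a) * conj_scalar (y 0 a) = inner x (conj_vec y).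
Proof. by apply: eq_bigr => a _; rewrite !mxE. Qed.

Section Contractions.
Variable k : nat.
Let e a : 'rV[F]_k := delta_mx 0 a.

(** The invariant 4-tensors, one per pairing of the four factors: 13 pairs the first with the third
    and the second with the fourth, and so on. *)
Definition contraction13 := \sum_a \sum_b tensor4 (e a) (e b) (e a) (e b).
Definition contraction14 := \sum_a \sum_b tensor4 (e a) (e b) (e b) (e a).
Definition contraction12 := \sum_a \sum_b tensor4 (e a) (e a) (e b) (e b).

Lemma inner_contraction13 (x y z t : 'rV[F]_k) :
  inner (tensor4 x y z t) contraction13 =
  inner x (conj_vec z) * inner y (conj_vec t).
Proof.
rewrite inner_sumr -!sum_conj mulr_suml; apply: eq_bigr => a _.
rewrite inner_sumr mulr_sumr; apply: eq_bigr => b _.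
by rewrite inner_tensor4 !inner_delta mulrACA.
Qed.

Lemma inner_contraction14 (x y z t : 'rV[F]_k) :
  inner (tensor4 x y z t) contraction14 =
  inner x (conj_vec t) * inner y (conj_vec z).
Proof.
rewrite inner_sumr -!sum_conj mulr_suml; apply: eq_bigr => a _.
rewrite inner_sumr mulr_sumr; apply: eq_bigr => b _.
rewrite inner_tensor4 !inner_delta; ring.
Qed.

Lemma inner_contraction12 (x y z t : 'rV[F]_k) :
  inner (tensor4 x y z t) contraction12 =
  inner x (conj_vec y) * inner z (conj_vec t).
Proof.
rewrite inner_sumr -!sum_conj mulr_suml; apply: eq_bigr => a _.
rewrite inner_sumr mulr_sumr; apply: eq_bigr => b _.
by rewrite inner_tensor4 !inner_delta.
Qed.

Lemma conj_vec_delta a : conj_vec (e a) = e a.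
Proof. by apply/matrixP => i j; rewrite !mxE rmorph_nat. Qed.

Lemma inner_delta2 a b : inner (e a) (e b) = (a == b)%:R.
Proof. by rewrite inner_delta mxE rmorph_nat eqxx eq_sym. Qed.

Lemma sum_delta (f : 'I_k -> 'I_k -> F) :
  (forall a b, f a b = (a == b)%:R) -> \sum_a \sum_b f a b = k%:R.
Proof.
move=> fE; rewrite -[k in RHS]card_ord -sumr_const; apply: eq_bigr => a _.
rewrite (bigD1 a) //= fE eqxx big1 ?addr0 // => b; rewrite fE eq_sym.
by move=> /negPf ->.
Qed.

Lemma sum_one (f : 'I_k -> 'I_k -> F) :
  (forall a b, f a b = 1) -> \sum_a \sum_b f a b = k%:R ^+ 2.
Proof.
move=> fE; under eq_bigr do under eq_bigr do rewrite fE.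
by rewrite !sumr_const card_ord -mulrnA mulnn natrX.
Qed.

Definition contractionE := (inner_contraction12, inner_contraction13,
  inner_contraction14).

Let eqb2 (b : bool) : b%:R * b%:R = b%:R :> F.
Proof. by rewrite -natrM mulnb andbb. Qed.

Local Ltac contract := rewrite inner_suml; under eq_bigr do
  (rewrite inner_suml; under eq_bigr do
     rewrite contractionE !conj_vec_delta !inner_delta2).

(** Gluing two pairings gives closed loops, each contributing a factor k: two loops if the pairings
    agree, one if they differ. *)
Lemma inner_contractions :
  [/\ inner contraction12 contraction12 = k%:R ^+ 2,
      inner contraction13 contraction13 = k%:R ^+ 2
    & inner contraction14 contraction14 = k%:R ^+ 2] /\
  [/\ inner contraction12 contraction13 = k%:R,
      inner contraction12 contraction14 = k%:R
    & inner contraction13 contraction14 = k%:R].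
Proof.
split; split; contract;
  by [apply: sum_one => a b; rewrite !eqxx mulr1 |
      apply: sum_delta => a b; rewrite ?[b == a]eq_sym eqb2].
Qed.

End Contractions.
End FourthMoment.

(* The number of lines in the equality case is k (k + theta - 1) / theta. *)
Definition theta (K : scalar_kind) : nat :=
  match K with RealScalars => 2 | ComplexScalars => 1 end.

Lemma conj_vecK (R : realType) (K : scalar_kind) k (x : 'rV[scalar R K]_k) :
  conj_vec (conj_vec x) = x.
Proof. by apply/matrixP => i j; rewrite !mxE conj_scalarK. Qed.

Lemma conj_vec_real (R : realType) (K : scalar_kind) k (x : 'rV[scalar R K]_k) :
  K = RealScalars -> conj_vec x = x.
Proof. by case: K x => x // _; apply/matrixP => i j; rewrite mxE. Qed.

(** With conjugates in the last two factors, the tensors p_i have Gram matrix |<u_i, u_j>|^4.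
    Comparison with a sum of invariant tensors whose inner product with p_i is constant gives a
    weighted second-order Welch bound. *)
Lemma fourth_moment_bound (R : realType) (K : scalar_kind) (k N : nat)
    (w : 'I_N -> R) (u : 'I_N -> 'rV[scalar R K]_k) :
  (0 < k)%N -> (forall i, inner (u i) (u i) = 1) ->
  (\sum_i w i) ^+ 2 * (1 + (theta K)%:R) <=
  k%:R * (k%:R + (theta K)%:R) *
    \sum_i \sum_j w i * w j * modulus (inner (u i) (u j)) ^+ 4.
Proof.
move=> k0 u1.
pose p i := tensor4 (u i) (u i) (conj_vec (u i)) (conj_vec (u i)).
have k1 : 1 <= k%:R :> R by rewrite ler1n.
have pp i j : inner (p i) (p j) = emb K (modulus (inner (u i) (u j)) ^+ 4).
  rewrite inner_tensor4 !inner_conj_vec -(conj_inner (u i)) mulrACA mul_conj.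
  by rewrite -rmorphM /= -exprD.
have [[h22 h33 h44] [h23 h24 h34]] := inner_contractions R K k.
have h32 := conj_inner (contraction12 R K k) (contraction13 R K k).
have h42 := conj_inner (contraction12 R K k) (contraction14 R K k).
have h43 := conj_inner (contraction13 R K k) (contraction14 R K k).
rewrite h23 rmorph_nat in h32; rewrite h24 rmorph_nat in h42.
rewrite h34 rmorph_nat in h43.
(* The pairings 13 and 14 evaluate to 1 on every p_i, over both fields; this q serves the complex
   case. *)
pose q := contraction13 R K k + contraction14 R K k.
have pq i : inner (p i) q = emb K 2.
  by rewrite innerDr !contractionE !conj_vecK u1 mulr1 rmorph_nat.
have qq : inner q q = emb K (2 * k%:R ^+ 2 + 2 * k%:R).
  rewrite /q !(innerDr, innerDl) h33 h44 h34 -h43.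
  by rewrite rmorphD !rmorphM !rmorph_nat; ring.
(* For real vectors the pairing 12 evaluates to 1 as well, and the sum of all three is used. *)
pose q' := contraction12 R K k + q.
have qq' : inner q' q' = emb K (3 * k%:R ^+ 2 + 6 * k%:R).
  rewrite /q' /q !(innerDr, innerDl) h22 h33 h44 h23 h24 h34 -h32 -h42 -h43.
  by rewrite !rmorphD !rmorphM !rmorph_nat; ring.
have pq' i : conj_vec (u i) = u i -> inner (p i) q' = emb K 3.
  move=> uE; rewrite innerDr pq contractionE !uE !u1 mulr1.
  by rewrite -(rmorph1 (@emb R K)) -rmorphD; congr emb; ring.
set W := \sum_i w i; set G := \sum_i \sum_j _.
have [KE|KE] : K = RealScalars \/ K = ComplexScalars.
  by case: (K); [left | right].
  have n0 : 0 < 3 * k%:R ^+ 2 + 6 * k%:R :> R by nra.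
  have pq3 i : inner (p i) q' = emb K 3 by apply: pq'; exact: conj_vec_real.
  have := gram_sum_lower_bound w pp pq3 qq' n0; rewrite -/W -/G.
  have -> : theta K = 2%N by rewrite KE.
  by move: W G => W G; nra.
have n0 : 0 < 2 * k%:R ^+ 2 + 2 * k%:R :> R by nra.
have := gram_sum_lower_bound w pp pq qq n0; rewrite -/W -/G.
have -> : theta K = 1%N by rewrite KE.
by move: W G => W G; nra.
Qed.

(** * Tight frames *)

Definition equiangle (R : realType) (k th : nat) : R :=
  (Num.sqrt (k%:R + th%:R))^-1.

(** This is a + (1 - a) / M with M th = k (k + th - 1): the mean of |<u_i, u_j>| over all ordered
    pairs, i = j included, from M equiangular lines of cosine a. *)
Definition frame_bound (R : realType) (k th : nat) : R :=
  let a := equiangle R k th in a + th%:R * a ^+ 2 / (k%:R * (1 + a)).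

Lemma frame_boundE (R : realType) (k th : nat) : (0 < k)%N ->
  let s : R := Num.sqrt (k%:R + th%:R) in
  frame_bound R k th = (k%:R * (s + 1) + th%:R) / (k%:R * s * (s + 1)).
Proof.
move=> k0 s; have k1 : 1 <= k%:R :> R by rewrite ler1n.
have s0 : 0 < s by rewrite sqrtr_gt0 -natrD ltr0n addn_gt0 k0.
rewrite /frame_bound /equiangle -/s; field.
by rewrite !gt_eqF //; lra.
Qed.

Lemma frame_bound_real (R : realType) (k : nat) : (0 < k)%N ->
  frame_bound R k 2 =
  ((k%:R - 1) * Num.sqrt (k%:R + 2) + 2) / (k%:R * (k%:R + 1)).
Proof.
move=> k0; rewrite frame_boundE //; set s := Num.sqrt _.
have k1 : 1 <= k%:R :> R by rewrite ler1n.
have s0 : 0 < s by rewrite sqrtr_gt0 -natrD ltr0n addn_gt0 k0.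
(* Both sides are rational in the square root s once k is eliminated. *)
have kE : k%:R = s ^+ 2 - 2 :> R by rewrite sqr_sqrtr ?addrK // addr_ge0.
apply/eqP; rewrite eqr_div; first last.
- by rewrite gt_eqF //; nra.
- by rewrite gt_eqF // !mulr_gt0 //; lra.
by rewrite kE; apply/eqP; ring.
Qed.

Lemma frame_bound_complex (R : realType) (k : nat) : (0 < k)%N ->
  frame_bound R k 1 = ((k%:R - 1) * Num.sqrt (k%:R + 1) + 1) / k%:R ^+ 2.
Proof.
move=> k0; rewrite frame_boundE //; set s := Num.sqrt _.
have k1 : 1 <= k%:R :> R by rewrite ler1n.
have s0 : 0 < s by rewrite sqrtr_gt0 -natrD ltr0n addn_gt0 k0.
have kE : k%:R = s ^+ 2 - 1 :> R by rewrite sqr_sqrtr ?addrK // addr_ge0.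
apply/eqP; rewrite eqr_div; first last.
- by rewrite gt_eqF //; nra.
- by rewrite gt_eqF // !mulr_gt0 //; lra.
by rewrite kE; apply/eqP; ring.
Qed.

Section TightFrames.
Variables (R : realType) (K : scalar_kind) (k N : nat).
Hypothesis k_gt0 : (0 < k)%N.
Local Notation F := (scalar R K).
Local Notation th := (theta K).
Local Notation alpha := (equiangle R k th).

(* The last clause, u_i^* (sum_j w_j u_j u_j^* ) u_i = 1, is all that is used of
   the isotropy sum_j w_j u_j u_j^* = I. *)
Definition tight_frame (w : 'I_N -> R) (u : 'I_N -> 'rV[F]_k) :=
  [/\ forall i, 0 <= w i, forall i, inner (u i) (u i) = 1, \sum_i w i = k%:R
    & forall i, \sum_j w j * modulus (inner (u i) (u j)) ^+ 2 = 1].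

(** The trace of the identity gives the total weight, and its value at u_i gives the last clause. *)
Lemma identity_tight_frame (w : 'I_N -> R) (u : 'I_N -> 'rV[F]_k) :
  (forall i, 0 <= w i) -> (forall i, inner (u i) (u i) = 1) ->
  \sum_i emb K (w i) *: (adjoint (u i) *m u i) = 1%:M ->
  tight_frame w u.
Proof.
move=> w0 u1 wu; split=> // [|i]; apply: (@emb_inj R K).
  rewrite rmorph_nat -(mxtrace1 F) -wu [RHS]raddf_sum rmorph_sum.
  apply: eq_bigr => i _; rewrite /= mxtraceZ mxtrace_mulC mul_adjoint u1.
  by rewrite mxtrace1 mulr1.
rewrite rmorph1 -(u1 i) -[X in _ = inner _ X]mulmx1 -wu mulmx_sumr inner_sumr.
rewrite rmorph_sum; apply: eq_bigr => j _ /=.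
rewrite rmorphM /= -mul_conj conj_inner -scalemxAr innerZr mulmxA mul_adjoint.
by rewrite mul_scalar_mx innerZr [inner (u j) _ * _]mulrC.
Qed.

(** Pythagoras for the component of y orthogonal to x; its nonnegativity is Cauchy-Schwarz, and its
    vanishing the case of parallel vectors. *)
Lemma inner_defect (x y : 'rV[F]_k) : inner x x = 1 ->
  inner (y - inner x y *: x) (y - inner x y *: x) =
  inner y y - emb K (modulus (inner x y) ^+ 2).
Proof.
move=> x1; rewrite innerBl !innerBr !innerZl !innerZr x1 mulr1 conj_inner.
by rewrite -(conj_inner x y) mul_conj [_ * inner x y]mulrC mul_conj subrr subr0.
Qed.

Lemma modulus_inner_le1 (x y : 'rV[F]_k) : inner x x = 1 -> inner y y = 1 ->
  modulus (inner x y) <= 1.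
Proof.
move=> x1 y1; rewrite -(@expr_le1 _ 2) ?modulus_ge0 // -(ler_emb K) -subr_ge0.
by rewrite rmorph1 -[X in X - _]y1 -inner_defect // inner_ge0.
Qed.

Lemma modulus_inner_eq1 (x y : 'rV[F]_k) : inner x x = 1 -> inner y y = 1 ->
  (modulus (inner x y) == 1) = (x == y)%MS.
Proof.
move=> x1 y1; apply/eqP/idP => [xy|/eqmxP xy].
  have yE : y = inner x y *: x.
    apply/eqP; rewrite -subr_eq0 -inner_eq0 inner_defect // y1 xy.
    by rewrite expr1n rmorph1 subrr.
  have c0 : inner x y != 0 by rewrite -modulus_eq0 xy oner_eq0.
  by rewrite yE; apply/eqmxP/eqmx_sym/eqmx_scale.
have /sub_rVP[c yE] : (y <= x)%MS by rewrite xy.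
have : modulus c ^+ 2 = 1.
  apply: (@emb_inj R K); rewrite -mul_conj rmorph1 -y1 yE innerZl innerZr x1.
  by rewrite mulr1 mulrC.
rewrite yE innerZr x1 mulr1 => /eqP; rewrite sqrp_eq1 ?modulus_ge0 //.
by move/eqP.
Qed.

Lemma equiangle_gt0 : 0 < alpha.
Proof. by rewrite invr_gt0 sqrtr_gt0 -natrD ltr0n addn_gt0 k_gt0. Qed.

Lemma equiangle_sqr : alpha ^+ 2 * (k%:R + th%:R) = 1.
Proof.
have p : 0 < k%:R + th%:R :> R by rewrite -natrD ltr0n addn_gt0 k_gt0.
by rewrite exprVn sqr_sqrtr ?ltW // mulVf ?gt_eqF.
Qed.

Lemma equiangle_lt1 : alpha < 1.
Proof.
have k1 : 1 <= k%:R :> R by rewrite ler1n.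
have th1 : 1 <= (th%:R : R) by rewrite ler1n; case: K.
have : alpha ^+ 2 * 2 <= 1.
  by rewrite -[leRHS]equiangle_sqr ler_wpM2l ?sqr_ge0 //; lra.
by have := equiangle_gt0; nra.
Qed.

Variables (w : 'I_N -> R) (u : 'I_N -> 'rV[F]_k).
Hypothesis wu : tight_frame w u.
Let t i j := modulus (inner (u i) (u j)).

(* With a = alpha, 2a(1+a)^2 t = a^2(2a+1) + (3a^2+2a+1) t^2 - t^4
   - (t-a)^2 (1-t) (t+2a+1): the defect is what is lost when t is replaced by
   its quartic majorant, which touches it at a and meets it at 1. *)
Definition defect := \sum_i \sum_j w i * w j *
  ((t i j - alpha) ^+ 2 * (1 - t i j) * (t i j + 2 * alpha + 1)).

Lemma defect_term_ge0 i j : 0 <= w i * w j *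
  ((t i j - alpha) ^+ 2 * (1 - t i j) * (t i j + 2 * alpha + 1)).
Proof.
have [w0 u1 _ _] := wu; have a0 := equiangle_gt0.
have t1 : t i j <= 1 by exact: modulus_inner_le1.
have t0 : 0 <= t i j by exact: modulus_ge0.
apply: mulr_ge0; first exact: mulr_ge0.
apply: mulr_ge0; last by rewrite !addr_ge0 // mulr_ge0 // ltW.
by rewrite mulr_ge0 ?sqr_ge0 ?subr_ge0.
Qed.

(** The quartic identity is summed over all pairs with weights. The moments of order 0 and 2 are k^2
    and k, and the lower bound on the fourth one turns the rest into the right-hand side. *)
Lemma tight_frame_defect :
  2 * alpha * (1 + alpha) ^+ 2 * \sum_i \sum_j w i * w j * t i j + defect <=
  2 * alpha * (1 + alpha) ^+ 2 * (k%:R ^+ 2 * frame_bound R k th).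
Proof.
have [w0 u1 sw swt] := wu; have a0 := equiangle_gt0; have a1 := equiangle_lt1.
have aE := equiangle_sqr.
have k1 : 1 <= k%:R :> R by rewrite ler1n.
pose S m := \sum_i \sum_j w i * w j * t i j ^+ m.
have -> : \sum_i \sum_j w i * w j * t i j = S 1%N by [].
have S0 : S 0%N = k%:R ^+ 2.
  rewrite -sw expr2 mulr_suml; apply: eq_bigr => i _; rewrite mulr_sumr.
  by apply: eq_bigr => j _; rewrite mulr1.
have S2 : S 2%N = k%:R.
  rewrite -sw; apply: eq_bigr => i _; rewrite -[RHS]mulr1 -(swt i) mulr_sumr.
  by apply: eq_bigr => j _; rewrite mulrA.
have S4 := fourth_moment_bound w k_gt0 u1; rewrite sw -/(S 4%N) in S4.
have dE : defect = alpha ^+ 2 * (2 * alpha + 1) * S 0%N +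
    (3 * alpha ^+ 2 + 2 * alpha + 1) * S 2%N - S 4%N
    - 2 * alpha * (1 + alpha) ^+ 2 * S 1%N.
  rewrite /S !mulr_sumr -big_split -!sumrB /=; apply: eq_bigr => i _.
  rewrite !mulr_sumr -big_split -!sumrB /=; apply: eq_bigr => j _.
  by ring.
rewrite dE addrC subrK S0 S2 /frame_bound.
have k0 : 0 < k%:R :> R by lra.
(* The fourth moment bound divided by k (k + th), using alpha^2 (k + th) = 1. *)
have {}S4 : (1 + th%:R) * alpha ^+ 2 * k%:R <= S 4%N.
  rewrite -(ler_pM2l k0) -(@ler_pM2r _ (k%:R + th%:R)); last first.
    by rewrite -natrD ltr0n addn_gt0 k_gt0.
  apply: le_trans (_ : k%:R ^+ 2 * (1 + th%:R) <= _); last first.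
    by rewrite [leRHS]mulrAC.
  have -> : k%:R * ((1 + th%:R) * alpha ^+ 2 * k%:R) * (k%:R + th%:R) =
    k%:R ^+ 2 * (1 + th%:R) * (alpha ^+ 2 * (k%:R + th%:R)) by ring.
  by rewrite aE mulr1.
apply: (@le_trans _ _ (alpha ^+ 2 * (2 * alpha + 1) * k%:R ^+ 2 +
  (3 * alpha ^+ 2 + 2 * alpha + 1) * k%:R - (1 + th%:R) * alpha ^+ 2 * k%:R)).
  by rewrite lerB.
(* What remains is an equality: a rational identity in k and alpha once th is eliminated. *)
rewrite le_eqVlt; apply/orP; left; apply/eqP.
have thE : th%:R = alpha ^- 2 - k%:R.
  have a20 : alpha ^+ 2 != 0 by rewrite sqrf_eq0 gt_eqF.
  have -> : alpha ^- 2 = k%:R + th%:R by apply: (mulfI a20); rewrite aE mulfV.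
  by rewrite addrC addKr.
rewrite thE; field.
by rewrite !gt_eqF //; lra.
Qed.

End TightFrames.

(** * The bound for a tight frame and its equality case *)

(** Cauchy-Schwarz with its exact remainder, which in the equality case forces the weights to be
    equal. *)
Lemma sum_sqr_variance (R : realType) (N : nat) (w : 'I_N -> R) : (0 < N)%N ->
  N%:R * \sum_i w i ^+ 2 =
  (\sum_i w i) ^+ 2 + N%:R * \sum_i (w i - (\sum_i w i) / N%:R) ^+ 2.
Proof.
move=> N0; have n0 : N%:R != 0 :> R by rewrite pnatr_eq0 -lt0n.
set W := \sum_i w i.
have -> : \sum_i (w i - W / N%:R) ^+ 2 =
    \sum_i w i ^+ 2 - 2 * (W / N%:R) * W + N%:R * (W / N%:R) ^+ 2.
  under eq_bigr => i _.
    have -> : (w i - W / N%:R) ^+ 2 =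
      w i ^+ 2 - 2 * (W / N%:R) * w i + (W / N%:R) ^+ 2 by ring.
    over.
  rewrite big_split sumrB -mulr_sumr sumr_const card_ord /=.
  by rewrite -[_ ^+ 2 *+ N]mulr_natl.
by field.
Qed.

Section TightFrameBounds.
Variables (R : realType) (K : scalar_kind) (k N : nat).
Hypotheses (k_gt0 : (0 < k)%N) (N_gt0 : (0 < N)%N).
Local Notation F := (scalar R K).
Local Notation th := (theta K).
Local Notation alpha := (equiangle R k th).
Local Notation b := (frame_bound R k th).
Variables (w : 'I_N -> R) (u : 'I_N -> 'rV[F]_k).
Hypothesis wu : tight_frame w u.
Let t i j := modulus (inner (u i) (u j)).

Lemma frame_bound_gt0 : 0 < b.
Proof.
have a0 := equiangle_gt0 R K k_gt0.
have k0 : 0 < k%:R :> R by rewrite ltr0n.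
have c0 : 0 <= th%:R * alpha ^+ 2 / (k%:R * (1 + alpha)).
  by rewrite divr_ge0 ?mulr_ge0 ?sqr_ge0 ?ler0n //; lra.
rewrite /frame_bound; lra.
Qed.

(** Both losses are kept: the variance of the weights and the defect of the quartic majorant. For L
    > b the sum would be positive; for L = b both losses vanish. *)
Lemma frame_bound_slack (L : R) :
  L * \sum_i w i ^+ 2 <= N%:R^-1 * \sum_i \sum_j w i * w j * t i j ->
  2 * alpha * (1 + alpha) ^+ 2 * (L - b) * (N%:R * \sum_i w i ^+ 2) +
  2 * alpha * (1 + alpha) ^+ 2 * b *
    (N%:R * \sum_i (w i - k%:R / N%:R) ^+ 2) + defect w u <= 0.
Proof.
have [w0 u1 sw _] := wu; have a0 := equiangle_gt0 R K k_gt0.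
have n0 : 0 < N%:R :> R by rewrite ltr0n.
set c := 2 * alpha * (1 + alpha) ^+ 2.
have c0 : 0 < c by rewrite !mulr_gt0 // addr_gt0.
rewrite -(ler_pM2l n0) mulVKf ?gt_eqF // => LT.
have := tight_frame_defect k_gt0 wu; rewrite -/c.
have := sum_sqr_variance w N_gt0; rewrite sw.
move: LT; set T := \sum_i \sum_j _; set V := \sum_i (_ - _) ^+ 2.
set W := \sum_i w i ^+ 2; set D := defect w u => LT VE DT.
rewrite -(ler_pM2l c0) in LT.
have -> : c * (L - b) * (N%:R * W) + c * b * (N%:R * V) + D =
  c * (N%:R * (L * W)) + D - c * (k%:R ^+ 2 * b).
  have -> : N%:R * V = N%:R * W - k%:R ^+ 2 by rewrite VE addrC addKr.
  by ring.
by rewrite subr_le0; apply: le_trans DT; rewrite lerD2r.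
Qed.

Lemma sum_sqr_gt0 : 0 < \sum_i w i ^+ 2.
Proof.
have [_ _ sw _] := wu.
have n0 : 0 < N%:R :> R by rewrite ltr0n.
rewrite -(pmulr_rgt0 _ n0) sum_sqr_variance // sw ltr_wpDr //.
  by rewrite mulr_ge0 ?sumr_ge0 // => i _; exact: sqr_ge0.
by rewrite exprn_gt0 ?ltr0n.
Qed.

Let c_gt0 : 0 < 2 * alpha * (1 + alpha) ^+ 2.
Proof.
have a0 := equiangle_gt0 R K k_gt0.
by rewrite !mulr_gt0 // addr_gt0.
Qed.

Let variance_ge0 : 0 <= N%:R * \sum_i (w i - k%:R / N%:R) ^+ 2.
Proof. by rewrite mulr_ge0 ?sumr_ge0 // => i _; exact: sqr_ge0. Qed.

Let defect_ge0 : 0 <= defect w u.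
Proof.
by apply: sumr_ge0 => i _; apply: sumr_ge0 => j _; exact: defect_term_ge0.
Qed.

Lemma tight_frame_bound (L : R) :
  L * \sum_i w i ^+ 2 <= N%:R^-1 * \sum_i \sum_j w i * w j * t i j -> L <= b.
Proof.
move=> /frame_bound_slack h; rewrite leNgt; apply/negP => bL.
suff : 0 < 2 * alpha * (1 + alpha) ^+ 2 * (L - b) * (N%:R * \sum_i w i ^+ 2).
  have : 0 <= 2 * alpha * (1 + alpha) ^+ 2 * b *
      (N%:R * \sum_i (w i - k%:R / N%:R) ^+ 2).
    by rewrite mulr_ge0 // ltW // mulr_gt0 // frame_bound_gt0.
  by move: h defect_ge0; lra.
apply: mulr_gt0; first by apply: mulr_gt0; rewrite ?subr_gt0.
by apply: mulr_gt0; rewrite ?ltr0n; last exact: sum_sqr_gt0.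
Qed.

Lemma tight_frame_equality :
  b * \sum_i w i ^+ 2 <= N%:R^-1 * \sum_i \sum_j w i * w j * t i j ->
  (forall i, w i = k%:R / N%:R) /\ (forall i j, t i j != 1 -> t i j = alpha).
Proof.
move=> /frame_bound_slack; rewrite subrr mulr0 mul0r add0r => h.
have n0 : 0 < N%:R :> R by rewrite ltr0n.
have cb0 : 0 < 2 * alpha * (1 + alpha) ^+ 2 * b.
  by rewrite mulr_gt0 // frame_bound_gt0.
have V0 : \sum_i (w i - k%:R / N%:R) ^+ 2 = 0.
  apply/eqP; rewrite -(mulrI_eq0 _ (lregP (lt0r_neq0 n0))).
  rewrite -(mulrI_eq0 _ (lregP (lt0r_neq0 cb0))) eq_le mulr_ge0 ?(ltW cb0) //.
  by rewrite andbT; move: h defect_ge0; lra.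
have wE i : w i = k%:R / N%:R.
  apply/eqP; rewrite -subr_eq0 -sqrf_eq0.
  by rewrite (psumr_eq0P _ V0) // => j _; exact: sqr_ge0.
split=> // i j tij1.
have D0 : defect w u = 0.
  apply/eqP; rewrite eq_le defect_ge0 andbT.
  by move: h; rewrite V0 !mulr0 add0r.
have [w0 u1 _ _] := wu; have a0 := equiangle_gt0 R K k_gt0.
have term_ge0 i' j' := defect_term_ge0 k_gt0 wu i' j'.
have row_ge0 i' : true -> 0 <= \sum_j' w i' * w j' *
    ((t i' j' - alpha) ^+ 2 * (1 - t i' j') * (t i' j' + 2 * alpha + 1)).
  by move=> _; apply: sumr_ge0.
have row0 : \sum_j' w i * w j' *
    ((t i j' - alpha) ^+ 2 * (1 - t i j') * (t i j' + 2 * alpha + 1)) = 0.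
  exact: (psumr_eq0P row_ge0 D0).
have /eqP : w i * w j *
    ((t i j - alpha) ^+ 2 * (1 - t i j) * (t i j + 2 * alpha + 1)) = 0.
  exact: (psumr_eq0P (fun j' _ => term_ge0 i j') row0).
(* The weights k / N are nonzero and t + 2 alpha + 1 > 0, so t is alpha or 1. *)
rewrite expr2 !mulf_eq0 orbb !wE mulf_eq0 orbb.
have t0 : 0 <= t i j by exact: modulus_ge0.
have k0 : k%:R != 0 :> R by rewrite pnatr_eq0 -lt0n.
rewrite invr_eq0 (negPf k0) gt_eqF //= subr_eq0 => /orP[/orP[/eqP //|]|].
  by rewrite subr_eq0 eq_sym (negPf tij1).
by rewrite gt_eqF //; lra.
Qed.

End TightFrameBounds.

(** * Counting the classes of parallel vectors *)

(** All classes have N / M elements, so there are M of them; r enumerates a transversal. *)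
Lemma uniform_partition_representatives (N M : nat) (E : rel 'I_N) :
  (0 < N)%N -> equivalence_rel E ->
  (forall i, (#|[set j | E i j]| * M = N)%N) ->
  exists r : 'I_M -> 'I_N, forall a c, a != c -> ~~ E (r a) (r c).
Proof.
move=> N0 Eeq card_cls.
pose P := equivalence_partition E [set: 'I_N].
have Eeq' : {in [set: 'I_N] & &, equivalence_rel E}.
  by move=> x y z _ _ _; exact: Eeq.
have PP : finset.partition P [set: 'I_N] := equivalence_partitionP Eeq'.
have PE i j : (j \in finset.pblock P i) = E i j.
  by rewrite finset.pblock_equivalence_partition ?inE.
have M0 : (0 < M)%N.
  by have := N0; rewrite -{1}(card_cls (Ordinal N0)) muln_gt0 => /andP[].
have cardP : {in P, forall A : {set 'I_N}, #|A| = (N %/ M)%N}.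
  move=> A AP.
  have [i iA] : exists i, i \in A.
    apply/set0Pn; apply: contraTneq AP => ->.
    by case/and3P: PP.
  have -> : A = [set j | E i j].
    apply/setP => j; rewrite inE -PE.
    by case/and3P: PP => _ tP _; rewrite (finset.def_pblock tP AP iA).
  by rewrite -[X in _ = (X %/ _)%N](card_cls i) mulnK.
have NM : (N %/ M * M = N)%N.
  by rewrite -[X in (X %/ _)%N](card_cls (Ordinal N0)) mulnK // card_cls.
have cardPM : #|P| = M.
  have := card_uniform_partition cardP PP; rewrite cardsT card_ord => NE.
  have NM0 : (0 < N %/ M)%N.
    by rewrite lt0n; apply: contraTneq N0 => z; rewrite NE z muln0.
  by apply/eqP; rewrite -(eqn_pmul2r NM0) -NE [(M * _)%N]mulnC NM.
pose X := transversal P [set: 'I_N].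
have XT : is_transversal X P [set: 'I_N] := transversalP PP.
have XM : M = #|X| by rewrite (card_transversal XT).
exists (fun a => enum_val (cast_ord XM a)) => a c; apply: contra => Eac.
have /enum_val_inj/cast_ord_inj -> // :
  enum_val (cast_ord XM a) = enum_val (cast_ord XM c).
apply: (finset.pblock_inj XT); rewrite ?enum_valP //.
case/and3P: PP => /eqP cP tP _.
by apply/eqP; rewrite finset.eq_pblock ?cP ?inE // PE.
Qed.

Section Counting.
Variables (R : realType) (K : scalar_kind) (k N M : nat).
Hypotheses (k_gt0 : (0 < k)%N) (N_gt0 : (0 < N)%N).
Local Notation F := (scalar R K).
Local Notation th := (theta K).
Local Notation alpha := (equiangle R k th).
Hypothesis ME : (M * th = k * (k + th).-1)%N.
Variables (w : 'I_N -> R) (u : 'I_N -> 'rV[F]_k).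
Hypothesis wu : tight_frame w u.
Let t i j := modulus (inner (u i) (u j)).
Hypothesis wE : forall i, w i = k%:R / N%:R.
Hypothesis tE : forall i j, t i j != 1 -> t i j = alpha.

(** For m vectors parallel to u_i, the tight frame condition at u_i reads (k / N) (m + alpha^2 (N -
    m)) = 1. Inserting alpha^2 = 1 / (k + th) gives m k (k + th - 1) = N th, that is m M = N. *)
Lemma card_parallel i : (#|[set j | (u i == u j)%MS]| * M = N)%N.
Proof.
have [_ u1 _ swt] := wu; set A := [set _ | _]; set m := #|_|.
have th0 : (0 < th)%N by case: K.
have := swt i; rewrite (bigID (mem A)) /=.
have tA j : j \in A -> t i j = 1.
  by rewrite inE -modulus_inner_eq1 // => /eqP.
have tC j : j \notin A -> t i j = alpha.
  by rewrite inE -modulus_inner_eq1 //; exact: tE.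
under eq_bigr => j jA do rewrite wE [modulus _]tA // expr1n mulr1.
under [X in _ + X]eq_bigr => j jA do rewrite wE [modulus _]tC //.
rewrite !sumr_const -[#|mem A|]/m.
have -> : #|[predC mem A]| = (N - m)%N.
  by rewrite -[N in RHS]card_ord -(cardC (mem A)) addKn.
have mN : (m <= N)%N by rewrite -[N]card_ord max_card.
rewrite -[X in X + _ = _]mulr_natr -[X in _ + X = _]mulr_natr.
rewrite natrB // => /eqP sE.
have aE := equiangle_sqr R K k_gt0.
have n0 : N%:R != 0 :> R by rewrite pnatr_eq0 -lt0n.
have kt : (k + th).-1%:R = k%:R + th%:R - 1 :> R.
  by rewrite -subn1 natrB ?addn_gt0 ?k_gt0 // natrD.
have ME' : M%:R * th%:R = k%:R * (k%:R + th%:R - 1) :> R.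
  by rewrite -natrM ME natrM kt.
apply/eqP; rewrite -(eqn_pmul2r th0) -(eqr_nat R) !natrM -mulrA ME'.
have {}sE : k%:R * (m%:R + alpha ^+ 2 * (N%:R - m%:R)) = N%:R :> R.
  transitivity (N%:R * (k%:R / N%:R * m%:R +
    k%:R / N%:R * alpha ^+ 2 * (N%:R - m%:R))); first by field.
  by rewrite (eqP sE) mulr1.
have {}sE : k%:R * (m%:R * (k%:R + th%:R) +
   alpha ^+ 2 * (k%:R + th%:R) * (N%:R - m%:R)) = N%:R * (k%:R + th%:R) :> R.
  by rewrite -[in RHS]sE; ring.
by apply/eqP; move: sE; rewrite aE; lra.
Qed.

(** Representatives of distinct classes are not parallel, so the modulus of their inner product is
    not 1 and must be alpha. *)
Lemma tight_frame_equiangular_lines :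
  equiangular_lines_exist R K M k /\ (M %| N)%N.
Proof.
have [_ u1 _ _] := wu.
split; last by rewrite -(card_parallel (Ordinal N_gt0)) dvdn_mull.
have [|r rE] := @uniform_partition_representatives N M
  (fun i j => (u i == u j)%MS) N_gt0 _ card_parallel.
  move=> i j l; split=> [|/eqmxP ij]; first by apply/eqmxP.
  apply/idP/idP => /eqmxP il; apply/eqmxP; last exact: eqmx_trans ij il.
  exact: eqmx_trans (eqmx_sym ij) il.
exists (fun a => u (r a)); split=> //.
exists alpha => a c /rE; rewrite -modulus_inner_eq1 //; exact: tE.
Qed.

End Counting.

(** * Uniform measures *)

Section UniformMeasures.
Local Open Scope classical_set_scope.
Variables (R : realType) (K : scalar_kind) (k : nat).
Local Notation F := (scalar R K).

(** The norm of F takes values in F, so the real radius e is embedded before comparing. *)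
Lemma modulus_continuous : continuous (@modulus R K).
Proof.
move=> x; apply/(@cvgrPdist_lt _ _ _ _ (nbhs_filter x)) => e e0.
have : \forall y \near x, `|x - y| < emb K e.
  suff e1 : 0 < emb K e by exact: (nbhs_ball_norm x (PosNum e1)).
  by rewrite -(rmorph0 (@emb R K)) ltr_emb.
apply: filterS => y xy; apply: le_lt_trans (modulus_dist _ _) _.
rewrite ltNge -(ler_emb K) emb_modulus; apply/negP => h.
by have := lt_le_trans xy h; rewrite ltxx.
Qed.

Lemma inner_continuous (v : vec R K k) : continuous (inner v : vec R K k -> F).
Proof.
apply: continuous_big => [|i _ x]; first exact: add_continuous.
apply: (@cvgMl_tmp F _ _ (nbhs_filter x)).
exact: (@coord_continuous F 1 k 0 i x).
Qed.

Lemma measurable_modulus_inner (v : vec R K k) :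
  measurable_fun [set: borel_vec R K k]
    ((fun x => modulus (inner v x)) : borel_vec R K k -> R).
Proof.
apply: (measurability _ (RGenOInfty.measurableE R)).
move=> _ [_ [x ->] <-]; rewrite setTI; apply: sub_sigma_algebra.
apply: open_comp; last exact: interval_open.
move=> y _; apply: continuous_comp; first exact: inner_continuous.
exact: modulus_continuous.
Qed.

Variables (m : nat) (X : 'M[F]_(m, k)) (mu : probability (borel_vec R K k) R).
Hypothesis Xmu : uniform_on X mu.

(** On measurable sets mu agrees with a scaled finite sum of Dirac masses, whose integral is
    computed termwise. *)
Lemma integral_uniform_on (v : vec R K k) :
  (\int[mu]_x (modulus (inner v x))%:E =
   (m%:R^-1 * \sum_(i < m) modulus (inner v (row i X)))%:E)%E.
Proof.
(* [msum] adds a sequence of measures, so the rows are continued by 0; only the first m terms are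
   summed. *)
pose r n : borel_vec R K k := if insub n is Some i then row i X else 0.
have rE (i : 'I_m) : r i = row i X by rewrite /r valK.
pose nu := msum (fun n => dirac (r n) : {measure set _ -> \bar R}) m.
have c0 : 0 <= m%:R^-1 :> R by rewrite invr_ge0 ler0n.
pose c : {nonneg R} := NngNum c0.
have mf : measurable_fun [set: borel_vec R K k]
    (EFin \o ((fun x => modulus (inner v x)) : borel_vec R K k -> R)).
  by apply/measurable_EFinP; exact: measurable_modulus_inner.
have f0 (x : borel_vec R K k) : [set: borel_vec R K k] x ->
    (0 <= (modulus (inner v x))%:E)%E.
  by rewrite lee_fin modulus_ge0.
rewrite (eq_measure_integral (mscale c nu)); last first.
  move=> A mA _; etransitivity; first exact: (Xmu mA).
  by congr (_ * _)%E; apply: eq_bigr => i _; rewrite rE.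
rewrite ge0_integral_mscale // ge0_integral_measure_sum // EFinM /=.
congr (_ * _)%E; rewrite -sumEFin; apply: eq_bigr => i _.
by rewrite integral_dirac // diracT mul1e rE.
Qed.

Lemma supp_uniform_on i : supp mu (row i X).
Proof.
have m0 : 0 < m%:R :> R by rewrite ltr0n; case: i => i; exact: leq_ltn_trans.
move=> U oU Ui; rewrite Xmu; last exact: sub_sigma_algebra.
rewrite mule_gt0 ?lte_fin ?invr_gt0 // (bigD1 i) //=.
rewrite diracE mem_set //.
apply: (@lt_le_trans _ _ 1%E); rewrite ?lte01 ?leeDl //.
exact: sume_ge0.
Qed.

(** If v is orthogonal to row i, the left side is zero; otherwise v and the row are nonzero and
    admissible in the two infima. *)
Lemma Lval_uniform_on (L : R) i (v : vec R K k) : (L%:E <= Lval mu)%E ->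
  L * modulus (inner v (row i X)) <=
  m%:R^-1 * \sum_(j < m) modulus (inner v (row j X)).
Proof.
have [vi0|vi0] := eqVneq (inner v (row i X)) 0.
  move=> _; rewrite vi0 (_ : modulus 0 = 0); last first.
    by apply/eqP; rewrite modulus_eq0.
  rewrite mulr0 mulr_ge0 ?invr_ge0 ?ler0n ?sumr_ge0 // => j _.
  exact: modulus_ge0.
move=> LL; rewrite -lee_fin -integral_uniform_on EFinM.
have p0 : 0 < modulus (inner v (row i X)).
  by rewrite lt_def modulus_eq0 vi0 modulus_ge0.
rewrite -lee_pdivlMr //.
have <- : ((modulus (inner v (row i X)))%:E^-1)%E =
    ((modulus (inner v (row i X)))^-1)%:E by rewrite inver gt_eqF.
apply: le_trans LL _; rewrite /Lval.
apply: (@le_trans _ _ (ereal_inf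
      [set ((\int[mu]_x (modulus (inner v x))%:E) /
            (modulus (inner v (row i X)))%:E)%E
      | v in [set v : vec R K k | v != 0]])).
  apply: ereal_inf_lbound; exists (row i X) => //.
  split; first exact: supp_uniform_on.
  by move=> /= xi0; move: vi0; rewrite xi0 inner0r eqxx.
apply: ereal_inf_lbound; exists v => //.
by apply/eqP => v0; move: vi0; rewrite v0 inner0l eqxx.
Qed.

End UniformMeasures.

(** The test vector [u i *m adjoint T] is u_i in the original coordinates: its inner product with
    x_j is w_j <u_i, u_j>. The inequality for i is then multiplied by w_i and summed. *)
Lemma Pset_tight_frame (R : realType) (K : scalar_kind) (d k : nat)
    (mu : probability (borel_vec R K k) R) (L : R) :
  (0 < k)%N -> @Pset R K d k mu -> (L%:E <= Lval mu)%E ->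
  exists (w : 'I_(d + k) -> R) (u : 'I_(d + k) -> vec R K k),
    tight_frame w u /\
    L * \sum_i w i ^+ 2 <=
    (d + k)%:R^-1 * \sum_i \sum_j w i * w j * modulus (inner (u i) (u j)).
Proof.
move=> k0 [X Xfull Xmu] LL.
have [T [w [u [w0 xT u1 wu]]]] := lewis_position Xfull k0.
exists w, u; split; first exact: identity_tight_frame.
rewrite !mulr_sumr; apply: ler_sum => i _.
under eq_bigr do rewrite -mulrA.
rewrite -mulr_sumr [leRHS]mulrCA expr2 [leLHS]mulrCA; apply: ler_wpM2l => //.
have vE j : modulus (inner (u i *m adjoint T) (row j X)) =
    w j * modulus (inner (u i) (u j)).
  by rewrite -inner_mulmx xT innerZr modulusM modulus_emb ger0_norm.
have := Lval_uniform_on Xmu i (u i *m adjoint T) LL.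
under eq_bigr do rewrite vE.
by rewrite vE u1 (_ : modulus 1 = 1) ?mulr1 // -(rmorph1 (@emb R K))
  modulus_emb normr1.
Qed.

(** * Limits of tight frames *)

Section UltraLimits.
Local Open Scope classical_set_scope.
Variables (R : realType) (U : set_system nat).
Hypothesis U_ultra : UltraFilter U.

Let U_proper : ProperFilter U := @ultra_proper _ _ U_ultra.
Existing Instance U_proper.

(** A cluster point exists in the compact interval [-B, B], and an ultrafilter converges to each of
    its cluster points. *)
Lemma bounded_ultra_cvg (x : nat -> R) (B : R) : (forall n, `|x n| <= B) ->
  exists l : R, x @ U --> l.
Proof.
move=> xB; have [|p [_ xp]] := @segment_compact R (- B) B (x @ U) _.
  by apply: (@filterE _ U) => n; rewrite /= in_itv /= -ler_norml.
exists p => A pA; have [//|UA] := in_ultra_setVsetC (x @^-1` A) U_ultra.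
have [y [yA Ay]] : ~` A `&` A !=set0 by apply: xp pA; exact: UA.
by [].
Qed.

Variable K : scalar_kind.
Local Notation F := (scalar R K).

(** Reduces convergence in F to two real sequences; over the reals the second one is 0. *)
Lemma scalar_real_coordinates : exists (c : F) (re im : F -> R),
  forall x, [/\ x = emb K (re x) + c * emb K (im x),
    `|re x| <= modulus x & `|im x| <= modulus x].
Proof.
case: K; first by exists 0, id, (fun=> 0) => x /=; rewrite mul0r addr0 normr0.
exists ('i)%C, (@complex.Re R), (@complex.Im R) => -[a b].
rewrite /modulus normc_def /=; split; first exact: complexE.
  by rewrite -sqrtr_sqr ler_wsqrtr // lerDl sqr_ge0.
by rewrite -sqrtr_sqr ler_wsqrtr // lerDr sqr_ge0.
Qed.

Lemma emb_cvg (x : nat -> R) (l : R) :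
  x @ U --> l -> emb K (x n) @[n --> U] --> emb K l.
Proof.
move=> xl; apply/cvgrPdist_lt => e e0.
have me0 : 0 < modulus e by rewrite lt_def modulus_eq0 gt_eqF // modulus_ge0.
have UF : Filter U by exact: _.
have := @cvgr_dist_lt _ _ _ _ UF _ _ xl _ me0.
apply: filterS => n xn; rewrite -rmorphB -emb_modulus modulus_emb.
by rewrite -(emb_ge0_modulus (ltW e0)) ltr_emb.
Qed.

Lemma bounded_scalar_ultra_cvg (x : nat -> F) (B : R) :
  (forall n, modulus (x n) <= B) -> exists l : F, x @ U --> l.
Proof.
move=> xB; have [c [re [im xE]]] := scalar_real_coordinates.
have [|a ra] := @bounded_ultra_cvg (re \o x) B.
  by move=> n; have [_ h _] := xE (x n); exact: le_trans h _.
have [|b ib] := @bounded_ultra_cvg (im \o x) B.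
  by move=> n; have [_ _ h] := xE (x n); exact: le_trans h _.
exists (emb K a + c * emb K b).
rewrite (_ : x = (fun n => emb K (re (x n)) + c * emb K (im (x n)))).
  by apply: cvgD; [exact: emb_cvg | apply: cvgMl_tmp; exact: emb_cvg].
by apply/funext => n; have [] := xE (x n).
Qed.

Lemma modulus_cvg (x : nat -> F) (l : F) :
  x @ U --> l -> modulus (x n) @[n --> U] --> modulus l.
Proof. by move=> xl; apply: cvg_comp xl _; exact: modulus_continuous. Qed.

Lemma conj_scalar_continuous : continuous (@conj_scalar R K).
Proof.
move=> x; apply/(@cvgrPdist_lt _ _ _ _ (nbhs_filter x)) => e e0.
apply: filterS (nbhs_ball_norm x (PosNum e0)) => y.
by rewrite /ball_ /= -rmorphB -!emb_modulus modulus_conj.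
Qed.

Lemma conj_scalar_cvg (x : nat -> F) (l : F) :
  x @ U --> l -> conj_scalar (x n) @[n --> U] --> conj_scalar l.
Proof. by move=> xl; apply: cvg_comp xl _; exact: conj_scalar_continuous. Qed.

Lemma inner_cvg k (x y : nat -> 'rV[F]_k) (a b : 'rV[F]_k) :
  (forall i, x n 0 i @[n --> U] --> a 0 i) ->
  (forall i, y n 0 i @[n --> U] --> b 0 i) ->
  inner (x n) (y n) @[n --> U] --> inner a b.
Proof.
move=> xa yb; apply: cvg_big => [|i _]; first exact: add_continuous.
by apply: cvgM => //; exact: conj_scalar_cvg.
Qed.

Lemma ultra_lim_eq (x : nat -> R) (l c : R) :
  x @ U --> l -> (forall n, x n = c) -> l = c.
Proof.
move=> xl xc; apply/eqP; rewrite eq_le.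
by rewrite (cvgr_to_le xl) ?(cvgr_to_ge xl) //; apply: filterE => n; rewrite xc.
Qed.

Lemma sum_cvg I (r : seq I) (f : I -> nat -> R) (l : I -> R) :
  (forall i, f i @ U --> l i) ->
  \sum_(i <- r) f i n @[n --> U] --> \sum_(i <- r) l i.
Proof. by move=> fl; apply: cvg_big => //; exact: add_continuous. Qed.

End UltraLimits.

Section TightFrameLimit.
Local Open Scope classical_set_scope.

(** Weights lie in [0, k] and coordinates have modulus at most 1, so everything converges along one
    ultrafilter; the clauses and the inequality are closed conditions. *)
Lemma tight_frame_limit (R : realType) (K : scalar_kind) (k N : nat) (b : R)
    (w : nat -> 'I_N -> R) (u : nat -> 'I_N -> 'rV[scalar R K]_k) :
  (forall n, tight_frame (w n) (u n)) ->
  (forall n, (b - n.+1%:R^-1) * \sum_i w n i ^+ 2 <=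
     N%:R^-1 * \sum_i \sum_j w n i * w n j * modulus (inner (u n i) (u n j))) ->
  exists (w' : 'I_N -> R) (u' : 'I_N -> 'rV[scalar R K]_k),
    tight_frame w' u' /\
    b * \sum_i w' i ^+ 2 <=
     N%:R^-1 * \sum_i \sum_j w' i * w' j * modulus (inner (u' i) (u' j)).
Proof.
move=> wu wuL.
(* U refines the filter at infinity, so 1 / (n + 1) still tends to 0 along U. *)
have [U [Uu Uoo]] := @ultraFilterLemma nat _ eventually_filter.
have /choice[w' w'E] : forall i, exists l : R, w n i @[n --> U] --> l.
  move=> i; apply: (@bounded_ultra_cvg _ _ Uu _ k%:R) => n.
  have [w0 _ <- _] := wu n; rewrite ger0_norm // (bigD1 i) //= lerDl.
  by apply: sumr_ge0.
have /choice[v vE] :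
    forall p, exists l : scalar R K, u n p.1 0 p.2 @[n --> U] --> l.
  move=> [i a]; apply: (@bounded_scalar_ultra_cvg _ _ Uu _ _ 1) => n /=.
  have [_ u1 _ _] := wu n.
  rewrite -(@expr_le1 _ 2) ?modulus_ge0 // -(ler_emb K) rmorph1 -(u1 i).
  rewrite -mul_conj /inner (bigD1 a) //= mulrC lerDl.
  by apply: sumr_ge0 => j _; rewrite mulrC mul_conj_ge0.
pose u' i : 'rV[scalar R K]_k := \row_a v (i, a).
have u'E i a : u n i 0 a @[n --> U] --> u' i 0 a.
  by rewrite mxE; exact: (vE (i, a)).
have tE i j : modulus (inner (u n i) (u n j)) @[n --> U] -->
    modulus (inner (u' i) (u' j)).
  by apply: modulus_cvg => //; apply: inner_cvg.
have m1 : modulus (1 : scalar R K) = 1.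
  by rewrite -(rmorph1 (@emb R K)) modulus_emb normr1.
exists w', u'; split; first split.
- move=> i; apply: (cvgr_to_ge (w'E i)); apply: filterE => n.
  by have [] := wu n.
- move=> i; rewrite -[LHS](emb_ge0_modulus (inner_ge0 _)).
  rewrite -[RHS](rmorph1 (@emb R K)).
  congr emb; apply: (ultra_lim_eq Uu (tE i i)) => n.
  by have [_ -> _ _] := wu n.
- have sw := @sum_cvg _ _ Uu _ (index_enum 'I_N) (fun i n => w n i) _ w'E.
  by apply: (ultra_lim_eq Uu sw) => n; have [] := wu n.
- move=> i.
  have swt : \sum_j w n j * modulus (inner (u n i) (u n j)) ^+ 2 @[n --> U] -->
      \sum_j w' j * modulus (inner (u' i) (u' j)) ^+ 2.
    apply: (@sum_cvg _ _ Uu _ _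
      (fun j n => w n j * modulus (inner (u n i) (u n j)) ^+ 2)) => j.
    exact: cvgM (w'E j) (cvgM (tE i j) (tE i j)).
  by apply: (ultra_lim_eq Uu swt) => n; have [_ _ _ ->] := wu n.
have bU : (b - n.+1%:R^-1) @[n --> U] --> b.
  rewrite -[X in _ --> X]subr0; apply: cvgB; first exact: cvg_cst.
  by move=> A /cvg_harmonic /Uoo.
have sww : (b - n.+1%:R^-1) * \sum_i w n i ^+ 2 @[n --> U] -->
    b * \sum_i w' i ^+ 2.
  apply: cvgM bU _; apply: (@sum_cvg _ _ Uu _ _ (fun i n => w n i ^+ 2)) => i.
  exact: cvgM (w'E i) (w'E i).
apply: (ler_cvg_to sww); last by apply: filterE => n; exact: wuL.
apply: cvgMl_tmp.
apply: (@sum_cvg _ _ Uu _ _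
  (fun i n => \sum_j w n i * w n j * modulus (inner (u n i) (u n j)))) => i.
apply: (@sum_cvg _ _ Uu _ _
  (fun j n => w n i * w n j * modulus (inner (u n i) (u n j)))) => j.
exact: cvgM (cvgM (w'E i) (w'E j)) (tE i j).
Qed.

End TightFrameLimit.

(** * The supremum over uniform masses and the final theorem *)

Section SupremumBound.
Variables (R : realType) (K : scalar_kind) (d k : nat).
Hypothesis k_gt0 : (0 < k)%N.
Local Notation b := (frame_bound R k (theta K)).

Let dk_gt0 : (0 < d + k)%N.
Proof. by rewrite addn_gt0 k_gt0 orbT. Qed.

Lemma calL_le_frame_bound : (calL R K d k <= b%:E)%E.
Proof.
apply: ge_ereal_sup => _ [mu muP <-].
have bound (L : R) : (L%:E <= Lval mu)%E -> L <= b.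
  move=> /(Pset_tight_frame k_gt0 muP) [w [u [wu]]].
  exact: tight_frame_bound.
case: (Lval mu) bound => [r||] bound; rewrite ?leNye // ?lee_fin ?bound //.
(* An infinite value would be above L = b + 1, which the bound rules out. *)
by exfalso; have := bound (b + 1) (leey _); lra.
Qed.

(** The supremum is approached within 1 / (n + 1), without assuming that it is attained; equality is
    analysed in the limit frame. *)
Lemma calL_eq_frame_bound (M : nat) : (M * theta K = k * (k + theta K).-1)%N ->
  calL R K d k = b%:E ->
  equiangular_lines_exist R K M k /\ (M %| d + k)%N.
Proof.
move=> ME calLE.
have /choice[p pE] : forall n : nat,
    exists p : ('I_(d + k) -> R) * ('I_(d + k) -> vec R K k),
    tight_frame p.1 p.2 /\ (b - n.+1%:R^-1) * \sum_i p.1 i ^+ 2 <=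
    (d + k)%:R^-1 *
      \sum_i \sum_j p.1 i * p.1 j * modulus (inner (p.2 i) (p.2 j)).
  move=> n; have n0 : 0 < n.+1%:R^-1 :> R by rewrite invr_gt0.
  have cfin : calL R K d k \is a fin_num by rewrite calLE.
  have [_ [mu muP <-]] := ub_ereal_sup_adherent n0 cfin.
  rewrite -/(calL R K d k) calLE -EFinB => /ltW.
  by move=> /(Pset_tight_frame k_gt0 muP) [w [u wu]]; exists (w, u).
have [w [u [wu wuL]]] := @tight_frame_limit R K k (d + k) b
  (fun n => (p n).1) (fun n => (p n).2) (fun n => (pE n).1) (fun n => (pE n).2).
have [wE tE] := tight_frame_equality k_gt0 dk_gt0 wu wuL.
exact: tight_frame_equiangular_lines wu wE tE.
Qed.

End SupremumBound.

Theorem theorem2p9 (R : realType) (d k : nat) (hd : (0 < d)%N) (hk : (0 < k)%N) :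
  let bR : R := ((k%:R - 1) * Num.sqrt (k%:R + 2) + 2) / (k%:R * (k%:R + 1)) in
  let bC : R := ((k%:R - 1) * Num.sqrt (k%:R + 1) + 1) / k%:R ^+ 2 in
  ((calL R RealScalars d k <= bR%:E)%E /\
   (calL R RealScalars d k = bR%:E ->
      equiangular_lines_exist R RealScalars 'C(k.+1, 2) k /\
      (d%:Z = - k%:Z %[mod 'C(k.+1, 2)%:Z])%Z)) /\
  ((calL R ComplexScalars d k <= bC%:E)%E /\
   (calL R ComplexScalars d k = bC%:E ->
      equiangular_lines_exist R ComplexScalars (k ^ 2) k /\
      (d%:Z = - k%:Z %[mod (k ^ 2)%:Z])%Z)).
Proof.
move=> bR bC.
(* The congruence says that M divides d + k, the number of vectors. *)
have modE M : (M %| d + k)%N -> (d%:Z = - k%:Z %[mod M%:Z])%Z.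
  by move=> Mdk; apply/eqP; rewrite eqz_mod_dvd opprK -PoszD.
rewrite /bR -frame_bound_real // /bC -frame_bound_complex //.
split; split; try exact: calL_le_frame_bound.
  case/(calL_eq_frame_bound hk (M := 'C(k.+1, 2))) => [|lines /modE //].
  by rewrite mulnC -mul_bin_diag bin1 addn2 mulnC.
case/(calL_eq_frame_bound hk (M := k ^ 2)%N) => [|lines /modE //].
by rewrite muln1 addn1 -mulnn.
Qed.
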